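(* Let $(G_n,d_n)$ be an admissible sequence such that $t(F,G_n,d_n)$ converges for all trees $F$. Then there is a unique involution-invariant Borel probability measure $\lambda$ on the space $M$ of consistent measure sequences such that $t(F,G_n,d_n)\to t(F,(M,\mathcal{B},\lambda,\deg))$ as $n\to\infty$ for all trees $F$, where $\deg$ is the canonical sub-Markov kernel on $M$.
   Context: Graphs are finite, simple and undirected. An admissible pair is a pair $(G,d)$ where $d\ge 1$ and $G$ is a graph with all degrees $\le d$; an admissible sequence is a sequence of admissible pairs. For a connected graph $F$ (in particular a tree), $t(F,G,d)=\hom(F,G)/\big(\mathrm{v}(G)d^{\,\mathrm{v}(F)-1}\big)$, where $\hom(F,G)$ is the number of homomorphisms and $\mathrm{v}$ the number of nodes. A sub-Markov kernel on a measurable space $(X,\mathcal{B})$ is a function $\deg:X\times\mathcal{B}\to[0,1]$, $(x,A)\mapsto\deg_A(x)$, such that $\deg_A$ is a measurable function for each $A\in\mathcal{B}$ and $\deg(x):A\mapsto\deg_A(x)$ is a measure for each $x\in X$. A probability measure $\lambda$ on $(X,\mathcal{B})$ is involution-invariant with respect to $\deg$ (equivalently $\deg$ is reversible with respect to $\lambda$) if $\int_A\deg_B\,d\lambda=\int_B\deg_A\,d\lambda$ for all $A,B\in\mathcal{B}$. Tree densities: let $(F,o)$ be a rooted tree. Label its nodes by $0,1,\dots,\mathrm{v}(F)-1$ so that $o$ has label $0$ and, for each $i\ge1$, node $i$ has a (unique) neighbor $j(i)<i$. Put $t((F,o),(X,x_0))=\int_X\cdots\int_X 1\;d\deg(x_{j(\mathrm{v}(F)-1)})(x_{\mathrm{v}(F)-1})\cdots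 d\deg(x_{j(1)})(x_1)$ (iterated integral, innermost variable $x_{\mathrm{v}(F)-1}$); this is independent of the labeling. For a reversible kernel on a probability space, $t(F,(X,\mathcal{B},\lambda,\deg))=\int_Xt((F,o),(X,x_0))\,d\lambda(x_0)$, which is independent of the root $o$. The space $M$: for a compact metric space $K$, let $\mathcal{M}(K)$ be the space of Borel measures on $K$ of total mass $\le1$ with the Lévy–Prokhorov metric (weak convergence); it is compact. A continuous map $f:K\to L$ induces the push-forward $f_*:\mathcal{M}(K)\to\mathcal{M}(L)$. Let $M_0$ be a point and $M_r=\mathcal{M}(M_{r-1})$ for $r\ge1$. Let $f_0:M_1\to M_0$ be the unique map and $f_r=(f_{r-1})_*:M_{r+1}\to M_r$. A consistent sequence is $\sigma=(\sigma_r)_{r=0}^\infty\in\prod_rM_r$ with $f_r(\sigma_{r+1})=\sigma_r$ for all $r$. $M$ is the set of consistent sequences with the subspace topology from the product (a compact metrizable space), and $\mathcal{B}$ is its Borel $\sigma$-algebra. The canonical sub-Markov kernel on $(M,\mathcal{B})$ is the unique one with $\deg_{\tilde A}(\sigma)=\sigma_{r+1}(A)$ for all $r\ge0$, all Borel $A\subseteq M_r$ and all $\sigma\in M$, where $\tilde A=\{\sigma\in M:\sigma_r\in A\}$. *)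

(* Defs.v *)
From HB Require Import structures.
From mathcomp Require Import all_boot all_order all_algebra.
From mathcomp Require Import all_classical all_reals all_analysis.
From mathcomp Require Import giry.

Set Implicit Arguments.
Unset Strict Implicit.
Unset Printing Implicit Defensive.

Import Order.TTheory GRing.Theory Num.Theory.
Import numFieldNormedType.Exports.

Local Open Scope classical_set_scope.
Local Open Scope ring_scope.

Record sgraph := SGraph {
  vert :> finType;
  adj : rel vert;
  adj_sym : symmetric adj;
  adj_irrefl : irreflexive adj }.

Definition is_tree (F : sgraph) : Prop :=
  [/\ (0 < #|F|)%N,
      (forall x y : F, connect (@adj F) x y) &
      (forall c : seq F, ucycle (@adj F) c -> (size c <= 2)%N)].

(* Graphs in an admissible pair are nonempty: hom_density divides by v(G). *)
Definition admissible (G : sgraph) (d : nat) : Prop :=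
  [/\ (0 < d)%N, (0 < #|G|)%N &
      (forall x : G, (#|[set y : G | adj x y]| <= d)%N)].

Definition hom (F G : sgraph) : nat :=
  #|[set h : {ffun F -> G} |
      [forall x, forall y, adj x y ==> adj (h x) (h y)]]|.

Definition hom_density (R : realType) (F G : sgraph) (d : nat) : R :=
  (hom F G)%:R / (#|G|%:R * d%:R ^+ #|F|.-1).

(* The pointed structure is only there because measurableType requires it. *)
HB.structure Definition PointedMetric (K : numDomainType) :=
  {M of Metric K M & Pointed M}.
Notation pmetricType := PointedMetric.type.

Notation borel X := (g_sigma_algebraType (@open X)).

Section trim.
Context {d} {T : measurableType d} {R : realType}.
Variable mu : subprobability T R.
Local Open Scope ereal_scope.

Definition trim (A : set T) : \bar R := if `[< measurable A >] then mu A else 0.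

Lemma trimE (A : set T) : measurable A -> trim A = mu A.
Proof. by move=> mA; rewrite /trim asboolT. Qed.

Lemma trim_nmeas (A : set T) : ~ measurable A -> trim A = 0.
Proof. by move=> mA; rewrite /trim asboolF. Qed.

Let trim0 : trim set0 = 0. Proof. by rewrite trimE. Qed.

Let trim_ge0 A : 0 <= trim A.
Proof. by rewrite /trim; case: ifP. Qed.

Let trim_sigma_additive : semi_sigma_additive trim.
Proof.
move=> F mF tF mUF; rewrite trimE//.
rewrite [X in X @ _ --> _](_ : _ = fun n => \sum_(0 <= i < n) mu (F i)).
  exact: measure_semi_sigma_additive.
by apply/funext => n; apply: eq_bigr => i _; rewrite trimE.
Qed.

HB.instance Definition _ :=
  isMeasure.Build _ _ _ trim trim0 trim_ge0 trim_sigma_additive.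

Let trim_setT : trim setT <= 1.
Proof. by rewrite trimE// sprobability_setT. Qed.

HB.instance Definition _ := Measure_isSubProbability.Build _ _ _ trim trim_setT.

End trim.

(* A library measure is a function on all sets, unconstrained outside the
   sigma-algebra.  Requiring the value 0 there makes equality in measures K
   the equality of Borel measures, without which levy_prokhorov would only be
   a pseudometric. *)
Definition measures (R : realType) (K : pmetricType R) : Type :=
  {mu : subprobability (borel K) R |
    forall A : set (borel K), ~ measurable A -> mu A = 0%E}.

Section measures.
Context {R : realType} {K : pmetricType R}.
Implicit Types mu nu : measures K.
Local Open Scope ereal_scope.

Definition of_subprobability (mu : subprobability (borel K) R) : measures K :=
  exist _ (trim mu : subprobability (borel K) R) (@trim_nmeas _ _ _ mu).

Lemma measures_eq mu nu :
  (forall A : set (borel K), measurable A -> sval mu A = sval nu A) -> mu = nu.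
Proof.
move=> munu; apply: eq_sig_hprop => /=; first by move=> *; exact: Prop_irrelevance.
have : sval mu = sval nu :> (set (borel K) -> \bar R).
  apply/funext => A; have [mA|mA] := pselect (measurable A); first exact: munu.
  by rewrite (svalP mu)// (svalP nu).
move: (sval mu) (sval nu) => [m1 c1] [m2 c2] /= m12; subst m2; congr (_ _).
move: c1 c2 => [[a1 a2] [b] [c] [e] [f] [g]] [[a1' a2'] [b'] [c'] [e'] [f'] [g']].
have ? := Prop_irrelevance a1 a1'; have ? := Prop_irrelevance a2 a2'; subst.
have ? := Prop_irrelevance b b'; have ? := Prop_irrelevance c c'.
have ? := Prop_irrelevance e e'; have ? := Prop_irrelevance f f'.
by have ? := Prop_irrelevance g g'; subst.
Qed.

Definition thickening (A : set K) (e : R) : set K :=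
  [set y | exists2 x, A x & (mdist x y < e)%R].

Definition lp_bound mu nu : set R := [set e | (0 < e)%R /\
  forall A : set (borel K), measurable A ->
    sval mu A <= sval nu (thickening A e) + e%:E /\
    sval nu A <= sval mu (thickening A e) + e%:E].

Definition levy_prokhorov mu nu : R := inf (lp_bound mu nu).


Lemma thickening_measurable (A : set K) e :
  measurable (thickening A e : set (borel K)).
Proof.
apply: sub_sigma_algebra; rewrite openE => y [x Ax xy].
rewrite /interior -nbhs_ballE; exists (e - mdist x y)%R => /=.
  by rewrite subr_gt0.
move=> z; rewrite ballEmdist/= ltrBrDl => xyz; exists x => //.
exact: le_lt_trans (metric_triangle _ _ _) xyz.
Qed.

Lemma le_thickening (A : set K) e e' : (e <= e')%R ->
  thickening A e `<=` thickening A e'.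
Proof. by move=> ee' y [x Ax xy]; exists x => //; exact: lt_le_trans ee'. Qed.

Lemma thickening_thickening (A : set K) e e' :
  thickening (thickening A e) e' `<=` thickening A (e + e').
Proof.
move=> z [y [x Ax xy] yz]; exists x => //.
by rewrite (le_lt_trans (metric_triangle _ y _))// ltrD.
Qed.

Lemma measures_le1 mu (A : set (borel K)) : measurable A -> sval mu A <= 1.
Proof.
move=> mA; rewrite (le_trans _ (@sprobability_setT _ _ _ (sval mu)))//.
by rewrite le_measure// inE.
Qed.

Lemma le_sval mu (A B : set (borel K)) : measurable A -> measurable B ->
  A `<=` B -> sval mu A <= sval mu B.
Proof. by move=> mA mB AB; rewrite le_measure// inE. Qed.

Lemma lp_bound1 mu nu : lp_bound mu nu 1%R.
Proof.
split=> // A mA; split; rewrite (le_trans (measures_le1 _ mA))// leeDr//.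
Qed.

Lemma lp_boundC mu nu : lp_bound mu nu `<=` lp_bound nu mu.
Proof. by move=> e [e0 munu]; split=> // A mA; have [] := munu A mA. Qed.

Lemma lp_bound_up mu nu e e' : (e <= e')%R -> lp_bound mu nu e ->
  lp_bound mu nu e'.
Proof.
move=> ee' [e0 munu]; split; first exact: lt_le_trans ee'.
move=> A mA; have [h1 h2] := munu A mA.
by split; [apply: (le_trans h1)|apply: (le_trans h2)];
  rewrite leeD ?lee_fin//; apply: le_sval;
  try exact: thickening_measurable; exact: le_thickening.
Qed.

Lemma lp_boundD nu mu xi e e' : lp_bound mu nu e -> lp_bound nu xi e' ->
  lp_bound mu xi (e + e')%R.
Proof.
move=> [e0 munu] [e'0 nuxi]; split; first exact: addr_gt0.
move=> A mA; split.
- have [h1 _] := munu A mA; apply: (le_trans h1).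
  have [h2 _] := nuxi _ (thickening_measurable A e).
  apply: (@le_trans _ _ ((sval xi (thickening (thickening A e) e') + e'%:E) + e%:E)).
    by rewrite leeD2r.
  rewrite EFinD -addeA [X in _ + X]addeC leeD2r//.
  apply: le_sval; try exact: thickening_measurable.
  exact: thickening_thickening.
- have [_ h1] := nuxi A mA; apply: (le_trans h1).
  have [_ h2] := munu _ (thickening_measurable A e').
  apply: (@le_trans _ _ ((sval mu (thickening (thickening A e') e) + e%:E) + e'%:E)).
    by rewrite leeD2r.
  rewrite EFinD -addeA leeD2r// addrC.
  apply: le_sval; try exact: thickening_measurable.
  exact: thickening_thickening.
Qed.

Lemma lp_bound_has_inf mu nu : has_inf (lp_bound mu nu).
Proof.
by split; [exists 1%R; exact: lp_bound1|exists 0%R => e [/ltW]].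
Qed.

Lemma levy_prokhorov_lt mu nu e :
  (levy_prokhorov mu nu < e)%R -> lp_bound mu nu e.
Proof.
move=> /(inf_lt (lp_bound_has_inf mu nu).1) [e' be' e'e].
exact: lp_bound_up (ltW e'e) be'.
Qed.

Lemma levy_prokhorov_le mu nu e : lp_bound mu nu e ->
  (levy_prokhorov mu nu <= e)%R.
Proof. by move=> be; apply: ge_inf be; have [] := lp_bound_has_inf mu nu. Qed.

Lemma levy_prokhorovxx mu : levy_prokhorov mu mu = 0%R.
Proof.
apply/eqP; rewrite eq_le; apply/andP; split; last first.
  by apply: lb_le_inf; [exists 1%R; exact: lp_bound1|move=> e [/ltW]].
apply/ler_addgt0Pl => e e0; rewrite addr0; apply: levy_prokhorov_le.
split=> // A mA; suff : sval mu A <= sval mu (thickening A e) + e%:E by [].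
rewrite (@le_trans _ _ (sval mu (thickening A e)))//.
  apply: le_sval => //; first exact: thickening_measurable.
  by move=> x Ax; exists x => //; rewrite mdistxx.
by rewrite leeDl// lee_fin ltW.
Qed.

Lemma levy_prokhorovC mu nu : levy_prokhorov mu nu = levy_prokhorov nu mu.
Proof. by congr inf; apply/seteqP; split; exact: lp_boundC. Qed.

Lemma levy_prokhorov_triangle nu mu xi :
  (levy_prokhorov mu xi <= levy_prokhorov mu nu + levy_prokhorov nu xi)%R.
Proof.
apply/ler_addgt0Pr => e e0; rewrite [X in (_ + X)%R]splitr addrACA.
apply: levy_prokhorov_le; apply: (@lp_boundD nu); apply: levy_prokhorov_lt;
  by rewrite ltrDl divr_gt0.
Qed.

Lemma bigcap_thickening (C : set K) : closed C ->
  \bigcap_n thickening C n.+1%:R^-1%R = C.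
Proof.
move=> cC; apply/seteqP; split=> [y Cy|y Cy n _]; last first.
  by exists y => //; rewrite mdistxx invr_gt0.
apply: cC => B; rewrite -nbhs_ballE => -[e /= e0 yeB].
have [n ne] : exists n, (n.+1%:R^-1 < e :> R)%R.
  by have [N _ /(_ N (leqnn N))] := near_infty_natSinv_lt (PosNum e0); exists N.
have [x Cx xy] := Cy n I; exists x; split=> //; apply: yeB.
by rewrite ballEmdist/= metric_sym (lt_trans xy).
Qed.

Lemma levy_prokhorov0_closed mu nu (C : set (borel K)) :
  levy_prokhorov mu nu = 0%R -> closed (C : set K) -> sval mu C <= sval nu C.
Proof.
move=> munu cC.
have mC : measurable C.
  rewrite -(setCK C); apply: measurableC; apply: sub_sigma_algebra.
  exact: closed_openC.
pose e n : R := (n.+1%:R^-1)%R.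
have cvg_thick : (fun n => sval nu (thickening C (e n)) + (e n)%:E) @ \oo -->
    sval nu C.
  rewrite -[X in _ --> X]adde0; apply: cvgeD; first by rewrite fin_num_adde_defl.
    rewrite -[X in _ --> sval nu X](bigcap_thickening cC).
    apply: nonincreasing_cvg_mu.
    - by rewrite (le_lt_trans (measures_le1 _ (thickening_measurable _ _)))// ltry.
    - by move=> n; exact: thickening_measurable.
    - by rewrite (bigcap_thickening cC).
    - move=> m n mn; apply/subsetPset/le_thickening.
      by rewrite lef_pV2 ?posrE// ler_nat.
  by apply/fine_cvgP; split; [exact: nearW|exact: cvg_harmonic].
rewrite -(cvg_lim _ cvg_thick)//; apply: lime_ge; first by apply/cvg_ex; eexists; exact: cvg_thick.
apply: nearW => n; have : (levy_prokhorov mu nu < e n)%R by rewrite munu invr_gt0.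
by move=> /levy_prokhorov_lt[_ /(_ C mC)[]].
Qed.

Lemma levy_prokhorov_eq0 mu nu : levy_prokhorov mu nu = 0%R -> mu = nu.
Proof.
move=> munu; apply: measures_eq.
have eq_closed (C : set (borel K)) : closed (C : set K) -> sval mu C = sval nu C.
  move=> cC; apply/eqP; rewrite eq_le !levy_prokhorov0_closed//.
  by rewrite levy_prokhorovC.
have eqT : sval mu setT = sval nu setT by apply: eq_closed; exact: closedT.
apply: (@g_sigma_algebra_measure_unique _ R (borel K) (@open K) _ (fun=> setT)) => //.
- exact: sub_sigma_algebra.
- by move=> _; exact: openT.
- by rewrite bigcup_const.
- by move=> A B; exact: openI.
- move=> U oU; have mU : measurable (U : set (borel K)) by exact: sub_sigma_algebra.
  have fin (xi : measures K) (A : set (borel K)) : measurable A -> sval xi A < +oo.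
    by move=> mA; rewrite (le_lt_trans (measures_le1 xi mA))// ltry.
  have E (xi : measures K) : sval xi U = sval xi setT - sval xi (~` U).
    rewrite -{1}(setCK U) -setTD measureD ?setTI ?fin//; exact: measurableC.
  apply: (eq_trans (E mu)); rewrite eqT eq_closed; last exact: open_closedC.
  exact/esym/E.
- by move=> _; rewrite (le_lt_trans (measures_le1 mu measurableT))// ltry.
Qed.

HB.instance Definition _ := gen_eqMixin (measures K).
HB.instance Definition _ := gen_choiceMixin (measures K).
HB.instance Definition _ := isPointed.Build (measures K)
  (of_subprobability (@mzero _ (borel K) R)).
HB.instance Definition _ := isMetric.Build R (measures K)
  levy_prokhorovxx levy_prokhorov_eq0 levy_prokhorovC levy_prokhorov_triangle.

End measures.

Section pushforward.
Context {R : realType} {K L : pmetricType R}.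

Lemma unif_continuousP_mdist (f : K -> L) : unif_continuous f <->
  (forall e, 0 < e -> exists2 del, 0 < del &
     forall x y, mdist x y < del -> mdist (f x) (f y) < e).
Proof.
split=> [uf e e0|uf E].
  have := uf [set xy | ball xy.1 e xy.2].
  rewrite -!entourage_ballE => /(_ _)[].
    by exists e.
  move=> del /= d0 h; exists del => // x y xy.
  by have := h (x, y); rewrite /= !ballEmdist; exact.
rewrite -!entourage_ballE => -[e /= e0 eE].
have [del d0 h] := uf e e0; exists del => // -[x y]/=; rewrite ballEmdist /= => xy.
by apply: eE => /=; rewrite ballEmdist/=; exact: h.
Qed.

Lemma unif_continuous_measurable (f : K -> L) : unif_continuous f ->
  measurable_fun setT (f : borel K -> borel L).
Proof.
move=> /unif_continuousP_mdist uf.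
apply: (@measurability _ _ (borel K) (borel L) setT f (@open L)) => //.
move=> _ [U oU <-]; rewrite setTI.
apply: sub_sigma_algebra; rewrite openE => x /= Ux.
have : nbhs (f x) U by exact: open_nbhs_nbhs.
rewrite -nbhs_ballE => -[e /= e0 eU]; have [del d0 h] := uf e e0.
rewrite /interior -nbhs_ballE; exists del => //= y; rewrite ballEmdist/= => xy.
by apply: eU; rewrite ballEmdist/=; exact: h.
Qed.

Definition push (f : K -> L) (uf : unif_continuous f) (mu : measures K) :
    measures L :=
  of_subprobability (giry_map (unif_continuous_measurable uf) (sval mu)).

Lemma pushE f (uf : unif_continuous f) mu (A : set (borel L)) :
  measurable A -> sval (push uf mu) A = sval mu (f @^-1` A).
Proof. by move=> mA; rewrite /= trimE. Qed.

End pushforward.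

Section push_unif.
Context {R : realType} {K L : pmetricType R}.

Lemma push_unif_continuous (f : K -> L) (uf : unif_continuous f) :
  unif_continuous (push uf : measures K -> measures L).
Proof.
apply/unif_continuousP_mdist => e e0.
have e20 : 0 < e / 2 by rewrite divr_gt0.
have [del d0 h] := (unif_continuousP_mdist f).1 uf _ e20.
exists (Num.min del (e / 2)); first by rewrite lt_min d0.
move=> mu nu /levy_prokhorov_lt [_ munu].
apply: (@le_lt_trans _ _ (e / 2)); last first.
  by rewrite ltr_pdivrMr// ltr_pMr// ltr1n.
apply: levy_prokhorov_le; split => // A mA.
have mfA : measurable (f @^-1` A : set (borel K)).
  by rewrite -[X in measurable X]setTI; exact: unif_continuous_measurable.
have mT : measurable (thickening A (e / 2) : set (borel L)).
  exact: thickening_measurable.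
have mfT : measurable (f @^-1` (thickening A (e / 2)) : set (borel K)).
  by rewrite -[X in measurable X]setTI; exact: unif_continuous_measurable.
have sub : thickening (f @^-1` A) (Num.min del (e / 2)) `<=`
    f @^-1` (thickening A (e / 2)).
  by move=> y [x Ax]; rewrite lt_min => /andP[xy _]; exists (f x) => //; exact: h.
have [h1 h2] := munu _ mfA; rewrite !pushE//.
by split; [apply: (le_trans h1)|apply: (le_trans h2)];
  rewrite leeD ?lee_fin ?ge_min ?lexx ?orbT//; apply: le_sval => //;
  exact: thickening_measurable.
Qed.

End push_unif.

(* The argument is the scalar field of the metric. *)
Definition one_point (R : realType) : Type := unit.

Section one_point.
Variable R : realType.

Let dist (_ _ : one_point R) : R := 0.

Let dist_eq0 (x y : one_point R) : dist x y = 0 -> x = y.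
Proof. by case: x; case: y. Qed.

Let dist_triangle (y x z : one_point R) : dist x z <= dist x y + dist y z.
Proof. by rewrite /dist addr0. Qed.

HB.instance Definition _ := Pointed.copy (one_point R) unit.
HB.instance Definition _ := isMetric.Build R (one_point R)
  (fun=> erefl) dist_eq0 (fun _ _ => erefl) dist_triangle.

End one_point.

Section consistent.
Variable R : realType.

Fixpoint M_ (r : nat) : pmetricType R :=
  if r is r'.+1 then measures (M_ r') else one_point R.

Lemma const_unif_continuous :
  unif_continuous ((fun=> point) : M_ 1 -> M_ 0).
Proof. by apply/unif_continuousP_mdist => e e0; exists 1. Qed.

(* Uniform continuity, the same as continuity on these compact spaces, is
   carried along because push needs it. *)
Fixpoint proj_ (r : nat) : {f : M_ r.+1 -> M_ r | unif_continuous f} :=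
  if r is r'.+1 return {f : M_ r.+1 -> M_ r | unif_continuous f}
  then exist _ (push (svalP (proj_ r')) : M_ r'.+2 -> M_ r'.+1)
         (push_unif_continuous (svalP (proj_ r')))
  else exist _ (fun=> point) const_unif_continuous.

Definition consistent : set (prod_topology M_) :=
  [set s | forall r, sval (proj_ r) (s r.+1) = s r].

Definition M : Type := set_type consistent.

Lemma consistent_point : consistent (fun=> point).
Proof.
case=> [|r]; first by [].
apply: measures_eq => A mA /=; rewrite trimE//= /pushforward.
by rewrite /trim /mzero; case: ifP; case: ifP.
Qed.

HB.instance Definition _ := Topological.on M.
HB.instance Definition _ := isPointed.Build M
  (exist _ (fun=> point) (mem_set consistent_point)).

End consistent.

Definition coord (R : realType) (r : nat) (s : M R) : M_ R r := set_val s r.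

Definition canonical (R : realType) (deg : R.-spker borel (M R) ~> borel (M R)) :=
  forall (r : nat) (A : set (borel (M_ R r))), measurable A ->
  forall s : M R, deg s [set t | A (coord r t)] = sval (coord r.+1 s) A.

(* Definite description; kdirac is the value in the case, which does not
   occur, of no canonical kernel. *)
Definition canonical_kernel (R : realType) : R.-spker borel (M R) ~> borel (M R) :=
  if pselect (exists deg, canonical deg) is left ex then projT1 (cid ex)
  else kdirac (@measurable_id _ (borel (M R)) setT).

Definition involution_invariant d (X : measurableType d) (R : realType)
    (deg : R.-spker X ~> X) (lam : probability X R) : Prop :=
  forall A B : set X, measurable A -> measurable B ->
    (\int[lam]_(x in A) deg x B = \int[lam]_(x in B) deg x A)%E.

(* l lists the nodes of F, starting with o, in such a way that l (p i) is the
   unique neighbour of l i listed before l i, for i > 0. *)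
Definition labeling (F : sgraph) (o : F) (l : {ffun 'I_#|F| -> F})
    (p : {ffun 'I_#|F| -> 'I_#|F|}) : bool :=
  [&& injectiveb l,
      [forall i : 'I_#|F|, (i == 0 :> nat) ==> (l i == o)] &
      [forall i : 'I_#|F|, forall j : 'I_#|F|,
         (0 < i)%N ==> (((j < i)%N && adj (l i) (l j)) == (j == p i))]].

Section tree_density.
Context {d} {X : measurableType d} {R : realType}.
Variable deg : R.-spker X ~> X.
Local Open Scope ereal_scope.

(* xs = [:: x_0; ...; x_(i-1)] and js = [:: j(i); ...; j(v(F)-1)]. *)
Fixpoint iterated_integral (js : seq nat) (xs : seq X) : \bar R :=
  if js is j :: js' then
    \int[deg (nth point xs j)]_x iterated_integral js' (rcons xs x)
  else 1.

Definition rooted_tree_density (F : sgraph) (o : F) (x0 : X) : \bar R :=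
  if [pick lp | labeling o lp.1 lp.2] is Some lp then
    iterated_integral (behead [seq val (lp.2 i) | i <- enum 'I_#|F|]) [:: x0]
  else 0.

Definition tree_density (lam : probability X R) (F : sgraph) : \bar R :=
  if [pick o : F] is Some o then \int[lam]_x rooted_tree_density o x else 0.

End tree_density.

(* Main.v *)
(* Map a node x of a graph G to the point of M whose entry r+1 is the image under
   the r-th entry of the normalized counting measure on the neighbours of x, and
   then G to the point s_G of M whose entry r+1 is the law of the r-th entry at a
   uniform random node.  The measure deg(s_G) is an involution-invariant law on M
   with the same tree densities as G.  By Prokhorov's theorem every M_r, hence M,
   is compact.  At a cluster point s of the points s_(G_n) the measure deg(s) is
   the required limit, because tree functions are continuous on M and are mapped
   to tree functions by integration with respect to deg.

   By induction on r, the tree functions on M_r separate points.  They are closed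
   under products, so by compactness and a monotone class argument their
   integrals determine a measure on M.  For an involution-invariant measure these
   integrals do not depend on the root: cutting an edge o o' writes the tree
   function at o as f (D g) and that at o' as g (D f), where D integrates with
   respect to deg.  Hence they are the tree densities, which gives uniqueness. *)

Require Import Defs.
From HB Require Import structures.
From mathcomp Require Import all_boot all_order all_algebra finmap.
From mathcomp Require Import all_classical all_reals all_analysis.
From mathcomp Require Import measurable_realfun giry zify ring lra.

Set Implicit Arguments.
Unset Strict Implicit.
Unset Printing Implicit Defensive.

Import Order.TTheory GRing.Theory Num.Theory.
Import numFieldNormedType.Exports.

Local Open Scope classical_set_scope.
Local Open Scope ring_scope.

(* [coord] alone now denotes the coordinate functions of vector.v. *)
Local Notation coord := Defs.coord.

(** * Measures from closed contents *)

(** [M] serves as its own space of laws: a point carries a measure on [M], so a limit law is found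
    as a limit of points, with no separate space of measures on [M]. Points converge along an
    ultrafilter finer than [\oo]; convergence of the densities turns this into a limit in [n].

    Weak limits along ultrafilters are built twice, for the compactness of [M_ r.+1] and for the
    canonical kernel, whose value at a point is a limit of measures on embedded copies of [M_ r]. A
    setwise limit is only finitely additive; its values on closed sets are kept and extended
    regularly to a measure.

    Involution invariance speaks of Borel sets, on which weak limits have no hold. On tree functions
    it reads $\int f\,Dg=\int g\,Df$ with tree functions under both integrals, which is a closed
    condition. Monotone classes translate between the two forms, one argument at a time. They need
    indicators from an algebra without lattice operations; explicit polynomials provide these. *)

Definition closed_content {R : realType} {X : topologicalType}
    (L : set X -> R) : Prop :=
  [/\ L set0 = 0,
      (forall A B, closed A -> closed B -> A `<=` B -> L A <= L B),
      (forall A B, closed A -> closed B -> L (A `|` B) <= L A + L B) &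
      (forall A B, closed A -> closed B -> A `&` B = set0 ->
         L A + L B <= L (A `|` B))].

Section closed_content.
Context {R : realType} {X : ptopologicalType} (L : set X -> R).
Context (Lc : closed_content L).
Context (cptX : compact [set: X]) (normX : normal_space X).
Local Open Scope ereal_scope.

Let inner (U : set X) : \bar R :=
  ereal_sup [set (L C)%:E | C in [set C | closed C /\ C `<=` U]].

Let inner_ge C U : closed C -> C `<=` U -> (L C)%:E <= inner U.
Proof. by move=> cC CU; apply: ereal_sup_ubound; exists C. Qed.

Let inner_le a U : (forall C, closed C -> C `<=` U -> (L C)%:E <= a) ->
  inner U <= a.
Proof. by move=> h; apply: ge_ereal_sup => _ [C [cC CU] <-]; exact: h. Qed.

Let inner_mono U V : U `<=` V -> inner U <= inner V.
Proof.
by move=> UV; apply: inner_le => C cC CU; apply: inner_ge => //; exact: subset_trans UV.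
Qed.

Let inner_ge0 U : 0 <= inner U.
Proof.
case: Lc => L0 _ _ _; rewrite -[leLHS]/(0%:E) -L0.
by apply: inner_ge => //; exact: closed0.
Qed.

Let inner0 : inner set0 = 0.
Proof.
apply/eqP; rewrite eq_le inner_ge0 andbT; apply: inner_le => C cC.
by rewrite subset0 => ->; case: Lc => ->.
Qed.

Let inner_fin U : inner U \is a fin_num.
Proof.
rewrite fin_numE gt_eqF ?(lt_le_trans _ (inner_ge0 _))//=.
rewrite lt_eqF// (@le_lt_trans _ _ (L setT)%:E) ?ltry//.
apply: inner_le => C cC _; rewrite lee_fin; case: Lc => _ Lm _ _.
by apply: Lm => //; exact: closedT.
Qed.

(** Normality splits a closed [C] covered by [U] and [V]: disjoint open [U'] and [V'] around [C \ U]
    and [C \ V] leave the closed pieces [C \ U'], inside [U], and [C \ V'], inside [V], whose union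
    is [C]. *)
Let innerU U V : open U -> open V -> inner (U `|` V) <= inner U + inner V.
Proof.
move=> oU oV; apply: inner_le => C cC CUV.
have cCU : closed (C `&` ~` U) by apply: closedI => //; exact: open_closedC.
have cCV : closed (C `&` ~` V) by apply: closedI => //; exact: open_closedC.
have dis : (C `&` ~` U) `&` (C `&` ~` V) = set0.
  by rewrite -subset0 => x [[Cx nUx] [_ nVx]]; case: (CUV x Cx).
have [U' [V' [oU' oV' CU' CV' UV']]] := (@normal_openP R X).1 normX _ _ cCU cCV dis.
have c1 : closed (C `&` ~` U') by apply: closedI => //; exact: open_closedC.
have c2 : closed (C `&` ~` V') by apply: closedI => //; exact: open_closedC.
have CE : C = (C `&` ~` U') `|` (C `&` ~` V').
  rewrite -setIUr -setCI; rewrite UV' setC0 setIT//.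
rewrite CE; apply: (@le_trans _ _ (L (C `&` ~` U') + L (C `&` ~` V'))%:E).
  by rewrite lee_fin; case: Lc => _ _ Ls _; exact: Ls.
rewrite EFinD; apply: leeD; apply: inner_ge => //.
  move=> x [Cx nUx]; apply: contrapT => nU; apply: nUx; exact: CU'.
move=> x [Cx nVx]; apply: contrapT => nU; apply: nVx; exact: CV'.
Qed.

Let inner_bigsetU (U : (set X)^nat) n : (forall i, open (U i)) ->
  inner (\big[setU/set0]_(i < n) U i) <= \sum_(0 <= i < n) inner (U i).
Proof.
move=> oU; elim: n => [|n IH]; first by rewrite big_ord0 inner0 big_nil.
rewrite big_ord_recr/= big_nat_recr//=.
apply: (le_trans (innerU _ _)) => //; last exact: leeD.
by rewrite -bigcup_mkord; exact: bigcup_open.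
Qed.

(** Compactness of [C] reduces a countable open cover to a finite one; this is the only source of
    countable subadditivity. *)
Let inner_bigcup (U : (set X)^nat) : (forall i, open (U i)) ->
  inner (\bigcup_i U i) <= \sum_(0 <= i <oo) inner (U i).
Proof.
move=> oU; apply: inner_le => C cC CU.
have cptC : compact C by apply: subclosed_compact cptX _.
have : \forall n \near \oo, C `<=` (\big[setU/set0]_(i < n) U i).
  apply: (compact_near_coveringP C).1 => // x /CU [k _ Ukx].
  exists (U k, [set n | (k < n)%N]) => /=.
    split; first exact: open_nbhs_nbhs.
    by exists k.+1.
  by move=> [y n]/= [Uky kn]; rewrite -bigcup_mkord; exists k.
move=> [n _ /(_ n (leqnn n))] Cn.
apply: (le_trans (inner_ge cC Cn)); apply: (le_trans (inner_bigsetU _ oU)).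
by apply: nneseries_lim_ge => i _ _; exact: inner_ge0.
Qed.

Let outer (A : set X) : \bar R :=
  ereal_inf [set inner U | U in [set U | open U /\ A `<=` U]].

Let outer_le A U : open U -> A `<=` U -> outer A <= inner U.
Proof. by move=> oU AU; apply: ereal_inf_lbound; exists U. Qed.

Let outer_ge A a : (forall U, open U -> A `<=` U -> a <= inner U) -> a <= outer A.
Proof. by move=> h; apply: le_ereal_inf_tmp => _ [U [oU AU] <-]; exact: h. Qed.

Let outer_open U : open U -> outer U = inner U.
Proof.
move=> oU; apply/eqP; rewrite eq_le outer_le//=.
by apply: outer_ge => V oV; exact: inner_mono.
Qed.

Let outer_ge0 A : 0 <= outer A.
Proof. by apply: outer_ge => *; exact: inner_ge0. Qed.

Let outer0 : outer set0 = 0.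
Proof. by rewrite outer_open ?inner0//; exact: open0. Qed.

Let outer_mono : {homo outer : A B / A `<=` B >-> A <= B}.
Proof.
by move=> A B AB; apply: outer_ge => U oU BU; apply: outer_le => //; exact: subset_trans BU.
Qed.

Let outer_fin A : outer A \is a fin_num.
Proof.
rewrite ge0_fin_numE// (@le_lt_trans _ _ (inner setT))//.
  by apply: outer_le => //; exact: openT.
by rewrite -ge0_fin_numE.
Qed.

Let outer_approx A (e : R) : (0 < e)%R ->
  exists U, [/\ open U, A `<=` U & inner U <= outer A + e%:E].
Proof.
move=> e0; have [_ [U [oU AU] <-] /ltW h] := lb_ereal_inf_adherent e0 (outer_fin A).
by exists U.
Qed.

Let outer_sigma_subadditive : sigma_subadditive outer.
Proof.
move=> A; apply/lee_addgt0Pr => e e0.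
apply: le_trans (epsilon_trick xpredT _ (ltW e0)); last by move=> n; exact: outer_ge0.
have [U UP] : {U : (set X)^nat & forall n, [/\ open (U n), A n `<=` U n &
    inner (U n) <= outer (A n) + (e / (2 ^ n.+1)%:R)%:E]}.
  apply: (@choice _ _ (fun n U => [/\ open U, A n `<=` U &
    inner U <= outer (A n) + (e / (2 ^ n.+1)%:R)%:E])) => n.
  by apply: outer_approx; rewrite divr_gt0// ltr0n expn_gt0.
have oU n : open (U n) by have [] := UP n.
apply: (@le_trans _ _ (inner (\bigcup_n U n))).
  apply: outer_le; first exact: bigcup_open.
  by apply: subset_bigcup => n _; have [] := UP n.
apply: (le_trans (inner_bigcup oU)); apply: lee_nneseries => n _.
  by move=> *; exact: inner_ge0.
by have [] := UP n.
Qed.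

HB.instance Definition _ := isOuterMeasure.Build R X outer
  outer0 outer_ge0 outer_mono outer_sigma_subadditive.

(** It suffices to test an open [V] around [A]. A closed [C] inside both [V] and [U], and then a
    closed [C'] inside [V \ C], are disjoint, so superadditivity of [L] bounds the sum of their
    contents by that of one closed subset of [V]. *)
Let outer_caratheodory_open U : open U -> outer.-caratheodory U.
Proof.
move=> oU; apply: le_caratheodory_measurable => A.
apply: outer_ge => V oV AV.
have oVU : open (V `&` U) by exact: openI.
rewrite -leeBrDr//; apply: (@le_trans _ _ (inner (V `&` U))).
  by apply: outer_le => //; exact: setSI.
apply: inner_le => C cC CVU; rewrite leeBrDr// addeC -leeBrDr//.
have oVC : open (V `&` ~` C) by apply: openI => //; exact: closed_openC.
apply: (@le_trans _ _ (inner (V `&` ~` C))).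
  by apply: outer_le => // x [Ax nUx]; split; [exact: AV|move=> /CVU []].
apply: inner_le => C' cC' C'V; rewrite leeBrDr// -EFinD.
apply: (@le_trans _ _ (L (C' `|` C))%:E).
  rewrite lee_fin; case: Lc => _ _ _; apply => //.
  by rewrite -subset0 => x [/C'V [_ nC] Cx].
apply: inner_ge; first exact: closedU.
by move=> x [/C'V[]//|/CVU[]].
Qed.

Let borel_caratheodory (A : set (borel X)) : measurable A -> outer.-caratheodory A.
Proof.
apply: smallest_sub; last by move=> U oU; exact: outer_caratheodory_open.
exact: (@sigma_algebra_measurable _ (caratheodory_type outer)).
Qed.

(** [L] need not be outer regular, so the measure may differ from it on closed sets. The two
    one-sided bounds that survive are exactly the two halves of a portmanteau criterion. *)
Lemma closed_content_measure : exists nu : {measure set (borel X) -> \bar R},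
  (forall C, closed C -> (L C)%:E <= nu C) /\
  (forall U a, open U -> (forall C, closed C -> C `<=` U -> (L C <= a)%R) ->
     nu U <= a%:E).
Proof.
pose nu : set (borel X) -> \bar R := outer.
have nu0 : nu set0 = 0 by exact: outer0.
have nu_ge0 A : 0 <= nu A by exact: outer_ge0.
have nu_add : semi_sigma_additive nu.
  move=> F mF tF mUF.
  apply: (@caratheodory_measure_sigma_additive R X outer) => //.
    by move=> i; exact: borel_caratheodory.
  exact: borel_caratheodory.
pose m := isMeasure.Build _ _ _ nu nu0 nu_ge0 nu_add.
pose mu : {measure set (borel X) -> \bar R} := HB.pack nu m.
exists mu; split=> [C cC|U a oU h] /=.
  by apply: outer_ge => U oU CU; exact: inner_ge.
by rewrite /nu outer_open//; apply: inner_le => C cC CU; rewrite lee_fin; exact: h.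
Qed.

End closed_content.

Section bounded_measure.
Context d (T : measurableType d) (R : realType).
Variable mu : {measure set T -> \bar R}.

(** The bound is an argument of a synonym of [mu], so that a stronger structure is attached to a
    measure already at hand while integrals against the two stay convertible. *)
Definition le1_measure (mu1 : (mu setT <= 1)%E) : set T -> \bar R := mu.

HB.instance Definition _ mu1 := Measure.copy (le1_measure mu1) mu.
HB.instance Definition _ mu1 :=
  Measure_isSubProbability.Build _ _ _ (le1_measure mu1) mu1.

Definition eq1_measure (mu1 : mu setT = 1%E) : set T -> \bar R := mu.

HB.instance Definition _ mu1 := Measure.copy (eq1_measure mu1) mu.
HB.instance Definition _ mu1 :=
  Measure_isProbability.Build _ _ _ (eq1_measure mu1) mu1.

End bounded_measure.

Lemma ultra_fmap {S T : Type} (f : S -> T) (U : set_system S) :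
  UltraFilter U -> UltraFilter (f @ U).
Proof.
move=> UU; split; first exact: fmap_proper_filter.
move=> G GG fUG; apply/seteqP; split=> // A GA.
have [//|nA] := in_ultra_setVsetC (f @^-1` A) UU.
by have /filter_ex[x []] : G (A `&` ~` A) by apply: filterI => //; exact: fUG.
Qed.

Lemma ultra_cvg_itv {R : realType} {I : Type} (U : set_system I)
    (f : I -> R) (a b : R) : UltraFilter U -> (forall i, a <= f i <= b) ->
  cvg (f @ U).
Proof.
move=> UU fab; have := @segment_compact R a b; rewrite compact_ultra.
move=> /(_ (f @ U)  (ultra_fmap f UU))[].
  by apply: (@filterE _ U) => i /=; rewrite in_itv/= fab.
by move=> l [_ fl]; apply/cvg_ex; exists l.
Qed.

Lemma subprobability_fin d (T : measurableType d) (R : realType)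
    (mu : subprobability T R) A : measurable A -> mu A \is a fin_num.
Proof.
move=> mA; rewrite ge0_fin_numE// (@le_lt_trans _ _ 1%E) ?ltry//.
by rewrite (le_trans _ (@sprobability_setT _ _ _ mu))// le_measure// inE.
Qed.

Lemma subprobability_fine01 d (T : measurableType d) (R : realType)
    (mu : subprobability T R) A : measurable A -> 0 <= fine (mu A) <= 1.
Proof.
move=> mA; rewrite fine_ge0//= -lee_fin fineK ?subprobability_fin//.
by rewrite (le_trans _ (@sprobability_setT _ _ _ mu))// le_measure// inE.
Qed.

Lemma open_measurable_borel {X : ptopologicalType} (U : set X) :
  open U -> measurable (U : set (borel X)).
Proof. exact: sub_sigma_algebra. Qed.

Lemma closed_measurable_borel {X : ptopologicalType} (C : set X) :
  closed C -> measurable (C : set (borel X)).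
Proof.
move=> cC; rewrite -[C]setCK; apply: measurableC; apply: open_measurable_borel.
exact: closed_openC.
Qed.

(** The limit of [m i A] along [U] exists for every Borel [A], the values being bounded. Restricted
    to closed sets it is a closed content, and the resulting measure inherits both portmanteau
    inequalities, with a slack [e] that makes them hold for [U]-almost all [i]. *)
Lemma ultra_limit_measure {R : realType} {X : ptopologicalType} {I : Type}
    (U : set_system I) (m : I -> subprobability (borel X) R) :
  UltraFilter U -> compact [set: X] -> normal_space X ->
  exists nu : subprobability (borel X) R, forall e : R, 0 < e ->
    (forall C : set X, closed C ->
       \forall i \near U, (m i C <= nu C + e%:E)%E) /\
    (forall V : set X, open V ->
       \forall i \near U, (nu V <= m i V + e%:E)%E).
Proof.
move=> UU cptX normX.
pose L A := lim (fine (m i A) @[i --> U]).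
have Lcvg (A : set (borel X)) : measurable A -> cvg (fine (m i A) @[i --> U]).
  by move=> mA; apply: ultra_cvg_itv => i; exact: subprobability_fine01.
have mC := @closed_measurable_borel X.
have mono i (A B : set (borel X)) : measurable A -> measurable B -> A `<=` B ->
    fine (m i A) <= fine (m i B).
  move=> mA mB AB; apply: fine_le; try exact: subprobability_fin.
  by rewrite le_measure// inE.
have le_lim (f g : I -> R) : cvg (f @ U) -> cvg (g @ U) -> (forall i, f i <= g i) ->
    lim (f @ U) <= lim (g @ U).
  move=> cf cg fg; rewrite -subr_ge0 -limB//; apply: limr_ge; first exact: is_cvgB.
  by apply: nearW => i; rewrite subr_ge0.
have LC : closed_content L.
  split=> [|A B /mC mA /mC mB AB|A B /mC mA /mC mB|A B /mC mA /mC mB AB].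
  - by apply: lim_near_cst => //; apply: nearW => i; rewrite measure0.
  - by apply: (le_lim _ _ (Lcvg _ mA) (Lcvg _ mB)); move=> i; exact: mono.
  - have mAB : measurable (A `|` B : set (borel X)) by exact: measurableU.
    rewrite -limD; [|exact: Lcvg..].
    apply: (le_lim _ _ (Lcvg _ mAB) (is_cvgD (Lcvg _ mA) (Lcvg _ mB))).
    move=> i; rewrite fctE -fineD ?subprobability_fin//.
    by apply: fine_le; rewrite ?fin_numD ?subprobability_fin//; exact: measureU2.
  - have mAUB : measurable (A `|` B : set (borel X)) by exact: measurableU.
    rewrite -limD; [|exact: Lcvg..].
    apply: (le_lim _ _ (is_cvgD (Lcvg _ mA) (Lcvg _ mB)) (Lcvg _ mAUB)).
    move=> i; rewrite fctE -fineD ?subprobability_fin//.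
    by rewrite measureU.
have [mu [muC muU]] := closed_content_measure LC cptX normX.
have mu1 : (mu setT <= 1)%E.
  apply: muU; first exact: openT.
  move=> C /mC cC _; apply: limr_le (Lcvg _ cC) _.
  by apply: nearW => i; have /andP[] := subprobability_fine01 (m i) cC.
exists (le1_measure mu1) => e e0; split=> [C cC|V oV].
  have mCC := mC _ cC.
  have /cvgr_dist_lt /(_ e e0) := Lcvg _ mCC.
  apply: filterS => i; rewrite ltr_distlC => /andP[_ h].
  apply: (@le_trans _ _ (L C + e)%:E); last by rewrite EFinD leeD2r//; exact: muC.
  by rewrite -[m i C]fineK ?subprobability_fin// lee_fin -lerBlDr; rewrite ltW// ltrBlDr.
have mV := open_measurable_borel oV.
have nuV : (mu V <= (L V)%:E)%E.
  apply: muU => // C /mC cC CV.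
  by apply: (le_lim _ _ (Lcvg _ cC) (Lcvg _ mV)); move=> i; exact: mono.
have /cvgr_dist_lt /(_ e e0) := Lcvg _ mV.
apply: filterS => i; rewrite ltr_distlC => /andP[h _].
apply: (le_trans nuV).
rewrite -[m i V]fineK ?subprobability_fin// -EFinD lee_fin -lerBlDr.
exact: ltW.
Qed.

(** * Compactness *)

Section metric_borel.
Context {R : realType} {K : pmetricType R}.
Implicit Types (A : set K) (x y : K).

Lemma nbhs_mdist x (P : set K) : nbhs x P <->
  exists2 e, 0 < e & forall y, mdist x y < e -> P y.
Proof.
rewrite -nbhs_ballE; split=> -[e /= e0 eP]; exists e => //.
  by move=> y xy; apply: eP; rewrite ballEmdist.
by move=> y; rewrite ballEmdist/=; exact: eP.
Qed.

Lemma thickening_open A e : open (thickening A e).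
Proof.
rewrite openE => y [x Ax xy]; rewrite /interior nbhs_mdist.
exists (e - mdist x y); first by rewrite subr_gt0.
move=> z; rewrite ltrBrDl => xyz; exists x => //.
exact: le_lt_trans (metric_triangle _ _ _) xyz.
Qed.

Lemma sub_thickening A e : 0 < e -> A `<=` thickening A e.
Proof. by move=> e0 x Ax; exists x => //; rewrite mdistxx. Qed.

Lemma closure_thickening A e : 0 < e -> closure A `<=` thickening A e.
Proof.
move=> e0 x /(_ [set y | mdist x y < e])[].
  by rewrite nbhs_mdist; exists e.
by move=> y [Ay xy]; exists y => //; rewrite metric_sym.
Qed.

Lemma measures_fin (mu : measures K) (A : set (borel K)) :
  measurable A -> sval mu A \is a fin_num.
Proof. exact: subprobability_fin. Qed.

End metric_borel.

Section compact_measures.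
Context {R : realType} {K : pmetricType R}.
Context (cptK : compact [set: K]).

Lemma compact_net (e : R) : 0 < e ->
  exists D : {fset K}, forall x, exists2 y, y \in D & mdist y x < e.
Proof.
move=> e0; have := cptK; rewrite compact_cover.
move=> /(_ K setT (fun y => thickening [set y] e))[].
- by move=> y _; exact: thickening_open.
- by move=> x _; exists x => //; exact: sub_thickening.
by move=> D _ DK; exists D => x; have [y yD [_ ->]] := DK x I; exists y.
Qed.

(** The portmanteau inequalities concern one set at a time, whereas the distance needs a bound
    uniform over all Borel [A]. A finite net [D] bridges this: each [A] is compared with a
    neighbourhood of one of the finitely many subsets [J] of [D], and finitely many conditions hold
    together on a set of the ultrafilter. *)
Lemma compact_measures : compact [set: measures K].
Proof.
rewrite compact_ultra => U UU _.
have nK : normal_space K.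
  by apply: compact_normal => //; exact: metric_hausdorff.
have [nu0 nuP] := ultra_limit_measure (fun mu : measures K => sval mu) UU cptK nK.
exists (of_subprobability nu0); split => //.
have nuE (A : set (borel K)) : measurable A ->
    sval (of_subprobability nu0) A = nu0 A by move=> mA /=; rewrite trimE.
move=> B; rewrite /= nbhs_mdist => -[e e0 eB].
(* The sets below satisfy: [A] lies in [V J], [V J] in the [2d]-thickening of [A], and the closure
   of [V J] in its [3d]-thickening. So the distance is at most [3d], below [e]. *)
pose d := e / 4.
have d0 : 0 < d by rewrite divr_gt0.
have [D DP] := compact_net d0.
pose V (J : {set D}) := thickening [set x | exists2 j, j \in J & x = val j] d.
have oV J : open (V J) by exact: thickening_open.
have mV J : measurable (V J : set (borel K)) by exact: open_measurable_borel.
have mcV J : measurable (closure (V J) : set (borel K)).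
  by apply: closed_measurable_borel; exact: closed_closure.
pose close J (mu : measures K) :=
  (sval mu (closure (V J)) <= nu0 (closure (V J)) + d%:E)%E /\
  (nu0 (V J) <= sval mu (V J) + d%:E)%E.
have UJ : U [set mu | forall J, close J mu].
  apply: (@filter_forall _ _ close) => J; apply: filterI.
    by apply: (nuP d d0).1; exact: closed_closure.
  exact: (nuP d d0).2.
apply: filterS UJ => mu UJ; apply: eB.
apply: (@le_lt_trans _ _ (d + d + d)); last by rewrite /d; lra.
apply: levy_prokhorov_le; split; first by rewrite !addr_gt0.
move=> A mA.
pose J := finset (fun j : D => `[< exists2 a, A a & mdist (val j) a < d >]).
have AV : A `<=` V J.
  move=> a Aa; have [y yD ya] := DP a; exists y => //.
  by exists [` yD]%fset => //; rewrite finset.inE; apply/asboolP; exists a.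
have VA : V J `<=` thickening A (d + d).
  move=> x [_ [j + ->] jx]; rewrite finset.inE => /asboolP[a Aa ja]; exists a => //.
  by rewrite (le_lt_trans (metric_triangle _ (val j) _))// ltrD// metric_sym.
have cVA : closure (V J) `<=` thickening A (d + d + d).
  apply: (subset_trans (closure_thickening d0)).
  apply: subset_trans (@thickening_thickening _ _ _ _ _).
  by move=> x [y /VA Vy yx]; exists y.
have mT e' : measurable (thickening A e' : set (borel K)) by exact: thickening_measurable.
have [h1 h2] := UJ J.
have dd : (d <= d + d + d)%R by lra.
rewrite !nuE//; split.
  apply: (@le_trans _ _ (nu0 (V J))); first by rewrite le_measure ?inE.
  apply: (le_trans h2); rewrite leeD ?lee_fin//.
  apply: le_sval => //; apply: subset_trans cVA; exact: subset_closure.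
apply: (@le_trans _ _ (sval mu (closure (V J)))).
  by apply: le_sval => //; apply: (subset_trans AV); exact: subset_closure.
apply: (le_trans h1); rewrite leeD ?lee_fin//.
by rewrite le_measure ?inE.
Qed.

End compact_measures.

Lemma unif_continuous_continuous {R : realType} {K L : pmetricType R}
    (f : K -> L) : unif_continuous f -> continuous f.
Proof.
move=> /unif_continuousP_mdist uf x B; rewrite /= nbhs_mdist => -[e e0 eB].
have [d d0 h] := uf e e0; apply/(@nbhs_mdist _ _ x (f @^-1` B)); exists d => // y xy.
by apply: eB; exact: h.
Qed.

Section compact_M.
Variable R : realType.

Lemma compact_M_ r : compact [set: M_ R r].
Proof.
elim: r => [|r IH]; last exact: compact_measures.
suff -> : [set: M_ R 0] = [set tt] by exact: compact_set1.
by apply/seteqP; split=> // -[].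
Qed.

Lemma coord_continuous r : continuous (@coord R r).
Proof.
move=> s; apply: (@continuous_comp (M R) (prod_topology (M_ R)) (M_ R r) set_val (proj r)).
  exact: initial_continuous.
exact: proj_continuous.
Qed.

Lemma proj__continuous r : continuous (sval (proj_ R r)).
Proof. exact: unif_continuous_continuous (svalP _). Qed.

Lemma coordS r (s : M R) : sval (proj_ R r) (coord r.+1 s) = coord r s.
Proof. by rewrite /coord; have := set_valP s; exact. Qed.

Lemma cvg_coord (F : set_system (M R)) (t : M R) : Filter F ->
  (forall r, coord r s @[s --> F] --> coord r t) -> F --> t.
Proof.
move=> FF Ft A [_ [[B Bop <-] Bt sBA]].
have : (set_val @ F : set_system (prod_topology (M_ R))) --> set_val t.
  apply/cvg_sup => r U [_ [[W oW <-] Wt WU]].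
  have FW : F (coord r @^-1` W) := Ft r W (open_nbhs_nbhs (conj oW Wt)).
  by apply: (@filterS _ F _ _ _ _ FW) => s; exact: WU.
move=> /(_ B (open_nbhs_nbhs (conj Bop Bt))) FB.
by apply: (@filterS _ F _ _ _ _ FB) => s; exact: sBA.
Qed.

Lemma compact_M : compact [set: M R].
Proof.
rewrite compact_ultra => U UU _.
have lim_ r : exists t : M_ R r, coord r s @[s --> U] --> t.
  have := @compact_M_ r; rewrite compact_ultra.
  by move=> /(_ _ (ultra_fmap (@coord R r) UU) filterT)[t [_ Ut]]; exists t.
have [t tP] : {t : prod_topology (M_ R) & forall r, coord r s @[s --> U] --> t r}.
  by exists (fun r => projT1 (cid (lim_ r))) => r; case: cid.
have ct : consistent t.
  move=> r.
  apply: (@cvg_unique _ (@metric_hausdorff R (M_ R r)) (coord r s @[s --> U]));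
    last exact: tP.
  rewrite (_ : coord r = sval (proj_ R r) \o coord r.+1); last first.
    by apply/funext => s; rewrite /= coordS.
  apply: (@cvg_comp _ _ _ (coord r.+1) (sval (proj_ R r)) U (nbhs (t r.+1))).
    exact: tP.
  exact: proj__continuous.
exists (exist _ t (mem_set ct)); split=> //; apply: cvg_coord => r.
by have := tP r; rewrite /coord set_valE.
Qed.

Lemma hausdorff_M : hausdorff_space (M R).
Proof.
move=> s t st; apply: val_inj; apply: functional_extensionality_dep => r.
apply: (@metric_hausdorff R (M_ R r)) => A B As Bt.
have [u [uA uB]] := st _ _ (@coord_continuous r s _ As) (@coord_continuous r t _ Bt).
by exists (coord r u).
Qed.

End compact_M.

Section measures_map.
Context {R : realType}.

Lemma measurable_preimage {K L : pmetricType R} (f : K -> L)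
    (A : set (borel L)) : unif_continuous f -> measurable A ->
  measurable (f @^-1` A : set (borel K)).
Proof.
move=> uf mA; rewrite -[X in measurable X]setTI.
exact: unif_continuous_measurable uf measurableT _ mA.
Qed.

Lemma push_comp {K L N : pmetricType R} (f : K -> L) (g : L -> N) (h : K -> N)
    (uf : unif_continuous f) (ug : unif_continuous g) (uh : unif_continuous h)
    (mu : measures K) :
  (forall x, g (f x) = h x) -> push ug (push uf mu) = push uh mu.
Proof.
move=> gfh; apply: measures_eq => A mA.
rewrite !pushE//; last exact: measurable_preimage.
by congr (sval mu _); apply/seteqP; split=> x /=; rewrite gfh.
Qed.

Lemma push_id {K : pmetricType R} (f : K -> K) (uf : unif_continuous f)
    (mu : measures K) : (forall x, f x = x) -> push uf mu = mu.
Proof.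
move=> fx; apply: measures_eq => A mA; rewrite pushE//.
by congr (sval mu _); apply/seteqP; split=> x /=; rewrite fx.
Qed.

(** Both inequalities are required because total masses may differ: either one alone allows one of
    the measures to be zero. *)
Lemma measures_eq_portmanteau {K : pmetricType R} (mu nu : measures K) :
  (forall C : set K, closed C -> (sval mu C <= sval nu C)%E) ->
  (forall V : set K, open V -> (sval nu V <= sval mu V)%E) -> mu = nu.
Proof.
move=> muC nuV; apply: levy_prokhorov_eq0; apply/eqP; rewrite eq_le.
apply/andP; split; last first.
  by apply: lb_le_inf; [exists 1; exact: lp_bound1|move=> e [/ltW]].
apply/ler_addgt0Pl => e e0; rewrite addr0; apply: levy_prokhorov_le.
split=> // A mA.
have mT : measurable (thickening A e : set (borel K)) by exact: thickening_measurable.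
have mcA : measurable (closure A : set (borel K)).
  by apply: closed_measurable_borel; exact: closed_closure.
split; rewrite -[leLHS]adde0; (apply: leeD; last by rewrite lee_fin ltW).
  apply: (@le_trans _ _ (sval mu (closure A))).
    by apply: le_sval => //; exact: subset_closure.
  apply: (le_trans (muC _ _)); first exact: closed_closure.
  by apply: le_sval => //; exact: closure_thickening.
apply: (@le_trans _ _ (sval nu (thickening A e))).
  by apply: le_sval => //; exact: sub_thickening.
by apply: nuV; exact: thickening_open.
Qed.

End measures_map.

(** * Right inverses of the coordinate maps *)

Section embedding.
Variable R : realType.

Lemma cst_unif_continuous {K L : pmetricType R} (l : L) :
  unif_continuous ((fun=> l) : K -> L).
Proof. by apply/unif_continuousP_mdist => e e0; exists 1 => // x y _; rewrite mdistxx. Qed.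

(* A uniformly continuous right inverse [M_ r -> M] of [coord r]: [M_ r.+1]
   consists of measures on [M_ r], pushed forward to every [M_ k]. *)
Fixpoint emb_ (r k : nat) : {f : M_ R r -> M_ R k | unif_continuous f} :=
  match r return {f : M_ R r -> M_ R k | unif_continuous f} with
  | 0 => exist _ (fun=> point) (cst_unif_continuous point)
  | r'.+1 => match k return {f : M_ R r'.+1 -> M_ R k | unif_continuous f} with
    | 0 => exist _ (fun=> point) (cst_unif_continuous point)
    | k'.+1 => exist _ (push (svalP (emb_ r' k')) : M_ R r'.+1 -> M_ R k'.+1)
                 (push_unif_continuous (svalP (emb_ r' k')))
    end
  end.

Definition emb r k : M_ R r -> M_ R k := sval (emb_ r k).

Lemma emb_unif r k : unif_continuous (@emb r k).
Proof. exact: svalP (emb_ r k). Qed.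

Lemma M_0_eq (x y : M_ R 0) : x = y.
Proof. by case: x; case: y. Qed.

Lemma proj_emb r k (x : M_ R r) : sval (proj_ R k) (emb k.+1 x) = emb k x.
Proof.
elim: r k x => [|r IH] k x.
  by have /(_ k) := @consistent_point R; case: k.
case: k => [|k]; first exact: M_0_eq.
rewrite /emb /=.
by apply: push_comp => y; exact: IH.
Qed.

Lemma emb_id r (x : M_ R r) : emb r x = x.
Proof.
by elim: r x => [|r IH] x; [exact: M_0_eq|exact: push_id].
Qed.

(** For [k <= r] the map [emb k] is an iterated projection. The induction descends from [k = r],
    applying [proj_] once on each side. *)
Lemma emb_coord r k (s : M R) : (k <= r)%N -> emb k (coord r s) = coord k s.
Proof.
move=> kr; rewrite -(subKn kr); elim: (r - k)%N (leq_subr k r) => [|n IH] nr.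
  by rewrite subn0 emb_id.
rewrite -[RHS]coordS -[LHS]proj_emb.
move: (IH (ltnW nr)); have -> : (r - n)%N = (r - n.+1).+1 by lia.
by move=> ->.
Qed.

Lemma emb_consistent r (x : M_ R r) :
  consistent (fun k => emb k x : M_ R k).
Proof. by move=> k; exact: proj_emb. Qed.

Definition embM r (x : M_ R r) : M R :=
  exist (fun t => t \in @consistent R) _ (mem_set (emb_consistent x)).

Lemma coord_embM r k (x : M_ R r) : coord k (embM x) = emb k x.
Proof. by rewrite /coord set_valE. Qed.

Lemma embM_continuous r : continuous (@embM r).
Proof.
move=> x; apply: cvg_coord => k.
rewrite (_ : (fun s => coord k s) @ (@embM r @ x) = @emb r k @ x).
  rewrite coord_embM.
  exact: (unif_continuous_continuous (@emb_unif r k)).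
by apply/seteqP; split=> A /=.
Qed.

End embedding.

(** * The canonical kernel *)

Section cylinders.
Variable R : realType.
Implicit Types (s : M R).

Definition cyl r (A : set (M_ R r)) : set (M R) := [set s | A (coord r s)].

Lemma cyl_lift r k (A : set (M_ R r)) : (r <= k)%N ->
  cyl A = cyl (@emb R k r @^-1` A).
Proof. by move=> rk; apply/seteqP; split=> s; rewrite /cyl/= emb_coord. Qed.

Lemma emb_measurable r k (A : set (M_ R r)) :
  measurable (A : set (borel (M_ R r))) ->
  measurable (@emb R k r @^-1` A : set (borel (M_ R k))).
Proof. by move=> mA; apply: measurable_preimage => //; exact: emb_unif. Qed.

Lemma emb_open r k (A : set (M_ R r)) : open A -> open (@emb R k r @^-1` A).
Proof.
move=> oA; apply: open_comp => // x _.
exact: (unif_continuous_continuous (@emb_unif R k r)).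
Qed.

Lemma continuous_measurable_borel {X Y : ptopologicalType} (f : X -> Y) :
  continuous f -> measurable_fun setT (f : borel X -> borel Y).
Proof.
move=> cf; apply: (@measurability _ _ (borel X) (borel Y) setT f (@open Y)) => //.
move=> _ [U oU <-]; rewrite setTI; apply: open_measurable_borel.
by apply: open_comp => // x _; exact: cf.
Qed.

Lemma coord_measurable r :
  measurable_fun setT (@coord R r : borel (M R) -> borel (M_ R r)).
Proof. by apply: continuous_measurable_borel; exact: coord_continuous. Qed.

Lemma cyl_measurable r (A : set (M_ R r)) :
  measurable (A : set (borel (M_ R r))) -> measurable (cyl A : set (borel (M R))).
Proof.
move=> mA; rewrite -[X in measurable X]setTI.
exact: coord_measurable measurableT _ mA.
Qed.

(** A single coordinate suffices because cylinders of levels [r] and [k] both lift to level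
    [maxn r k]. Hence the sets with the asserted property form a filter, and it converges to [s]
    coordinate by coordinate. *)
Lemma nbhs_cyl s (O : set (M R)) : nbhs s O ->
  exists r (V : set (M_ R r)), [/\ open V, V (coord r s) & cyl V `<=` O].
Proof.
pose F : set_system (M R) := [set O | exists r (V : set (M_ R r)),
  [/\ open V, V (coord r s) & cyl V `<=` O]].
have FF : Filter F.
  split=> [|A B [r [V [oV Vs VA]]] [k [W [oW Ws WB]]]|A B AB [r [V [oV Vs VA]]]].
  - by exists 0%N, setT; split=> //; exact: openT.
  - exists (maxn r k), ((@emb R (maxn r k) r @^-1` V) `&` (@emb R (maxn r k) k @^-1` W)).
    split; first by apply: openI; exact: emb_open.
      by split; rewrite /= emb_coord// (leq_maxl, leq_maxr).
    move=> t [/= Vt Wt]; split.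
      by apply: VA; rewrite (cyl_lift V (leq_maxl r k)).
    by apply: WB; rewrite (cyl_lift W (leq_maxr r k)).
  - by exists r, V; split=> //; exact: subset_trans AB.
suff : F --> s by apply.
apply: cvg_coord => r A; rewrite nbhsE => -[V [oV Vs] VA].
by exists r, V; split=> // t Vt; exact: VA.
Qed.

Definition cyls : set (set (M R)) := [set O | exists r (A : set (M_ R r)),
  measurable (A : set (borel (M_ R r))) /\ O = cyl A].

Lemma setI_closed_cyls : setI_closed cyls.
Proof.
move=> _ _ [r [A [mA ->]]] [k [B [mB ->]]].
exists (maxn r k), ((@emb R (maxn r k) r @^-1` A) `&` (@emb R (maxn r k) k @^-1` B)).
split; first by apply: (@measurableI _ (borel _)); exact: emb_measurable.
by rewrite (cyl_lift A (leq_maxl r k)) (cyl_lift B (leq_maxr r k)).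
Qed.

Lemma borel_cyls : @measurable _ (borel (M R)) = <<s cyls >>.
Proof.
apply/seteqP; split; last first.
  apply: smallest_sub; first exact: sigma_algebra_measurable.
  by move=> _ [r [A [mA ->]]]; exact: cyl_measurable.
apply: smallest_sub; first exact: smallest_sigma_algebra.
move=> O oO.
(* All open cylinder bases of one level are merged into one open set, so that only a countable union
   over the levels remains. *)
pose V r := \bigcup_(W in [set W : set (M_ R r) | open W /\ cyl W `<=` O]) W.
have -> : O = \bigcup_r cyl (V r).
  apply/seteqP; split=> [s Os|s [r _ [W [_ WO] Ws]]]; last exact: WO.
  have [r [W [oW Ws WO]]] := nbhs_cyl (open_nbhs_nbhs (conj oO Os)).
  by exists r => //; exists W.
apply: sigma_algebra_bigcup => r; apply: sub_sigma_algebra.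
exists r, (V r); split=> //; apply: open_measurable_borel.
by apply: bigcup_open => W [].
Qed.

Lemma cyls_ind (P : set (M R) -> Prop) :
  P setT ->
  (forall r (A : set (borel (M_ R r))), measurable A -> P (cyl A)) ->
  (forall A : set (borel (M R)), measurable A -> P A -> P (~` A)) ->
  (forall A : (set (borel (M R)))^nat, (forall n, measurable (A n)) ->
     trivIset setT A -> (forall n, P (A n)) -> P (\bigcup_n A n)) ->
  forall A : set (borel (M R)), measurable A -> P A.
Proof.
move=> PT Pcyl PC PU A; rewrite {1}borel_cyls.
apply: (@dynkin_induction _ (borel (M R)) cyls P) => //.
- exact: borel_cyls.
- exact: setI_closed_cyls.
- by move=> _ [r [B [mB ->]]]; exact: Pcyl.
Qed.

Lemma measure_eq_cyls (mu nu : subprobability (borel (M R)) R) :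
  (forall r (A : set (borel (M_ R r))), measurable A -> mu (cyl A) = nu (cyl A)) ->
  forall A : set (borel (M R)), measurable A -> mu A = nu A.
Proof.
move=> munu; have munuT : mu setT = nu setT.
  by rewrite (_ : setT = @cyl 0 setT) ?munu//; apply/seteqP; split.
apply: cyls_ind => // [A mA munuA|A mA tA munuA].
- have fin (xi : subprobability (borel (M R)) R) : (xi setT < +oo)%E.
    by rewrite -ge0_fin_numE// subprobability_fin.
  have E (xi : subprobability (borel (M R)) R) : xi (~` A) = (xi setT - xi A)%E.
    by rewrite -setTD measureD ?fin// setTI.
  by rewrite !E munuT munuA.
- rewrite !measure_bigcup//.
  by apply: eq_eseriesr => n _; exact: munuA.
Qed.

End cylinders.

Section evaluation.
Context {R : realType} {K : pmetricType R}.
Local Open Scope ereal_scope.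

Lemma thickening_lt (mu : measures K) (C : set K) (a : R) : closed C ->
  sval mu C < a%:E -> exists2 e : R, (0 < e)%R &
    sval mu (thickening C e) + e%:E < a%:E.
Proof.
move=> cC muCa; apply: contrapT => h.
pose e n : R := (n.+1%:R^-1)%R.
have mC : measurable (C : set (borel K)) by exact: closed_measurable_borel.
have cvg_thick : (fun n => sval mu (thickening C (e n)) + (e n)%:E) @ \oo -->
    sval mu C.
  rewrite -[X in _ --> X]adde0; apply: cvgeD; first by rewrite fin_num_adde_defl.
    rewrite -[X in _ --> sval mu X](bigcap_thickening cC).
    apply: nonincreasing_cvg_mu.
    - by rewrite (le_lt_trans (measures_le1 _ (thickening_measurable _ _)))// ltry.
    - by move=> n; exact: thickening_measurable.
    - by rewrite (bigcap_thickening cC).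
    - move=> m n mn; apply/subsetPset/le_thickening.
      by rewrite lef_pV2 ?posrE// ler_nat.
  by apply/fine_cvgP; split; [exact: nearW|exact: cvg_harmonic].
move: muCa; rewrite ltNge => /negP; apply.
rewrite -(cvg_lim _ cvg_thick)//; apply: lime_ge.
  by apply/cvg_ex; eexists; exact: cvg_thick.
apply: nearW => n; rewrite leNgt; apply/negP => en; apply: h.
by exists (e n) => //; rewrite invr_gt0.
Qed.

(** Evaluation at a closed set is upper semicontinuous: within distance [e] of [mu] the mass of [C]
    is at most the [mu]-mass of its [e]-thickening plus [e]. *)
Lemma eval_lt_open (C : set K) (a : R) : closed C ->
  open [set mu : measures K | sval mu C < a%:E].
Proof.
move=> cC; rewrite openE => mu /= muC.
have [e e0 he] := thickening_lt cC muC.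
rewrite /interior nbhs_mdist; exists e => // nu /levy_prokhorov_lt [_ h].
have [_ h2] := h C (closed_measurable_borel cC).
exact: le_lt_trans h2 he.
Qed.

End evaluation.

Local Open Scope ereal_scope.

Lemma eval_measurable (R : realType) r (A : set (borel (M_ R r))) : measurable A ->
  measurable_fun setT ((fun mu : M_ R r.+1 => sval mu A) : borel (M_ R r.+1) -> \bar R).
Proof.
have eqK : @measurable _ (borel (M_ R r)) = <<s @closed (M_ R r) >>.
  apply/seteqP; split; apply: smallest_sub.
  - exact: smallest_sigma_algebra.
  - move=> O oO; rewrite -(setCK O) -setTD; apply: sigma_algebraCD.
    by apply: sub_sigma_algebra; exact: open_closedC.
  - exact: sigma_algebra_measurable.
  - by move=> C cC; exact: closed_measurable_borel.
pose P (A : set (borel (M_ R r))) :=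
  measurable_fun setT ((fun mu : M_ R r.+1 => sval mu A) : borel (M_ R r.+1) -> \bar R).
have PC C : closed C -> P C.
  move=> cC; apply: (measurability _ (ErealGenInftyO.measurableE R)).
  move=> _ /= [_ [a ->] <-]; rewrite setTI.
  apply: open_measurable_borel.
  rewrite (_ : _ @^-1` _ = [set mu : M_ R r.+1 | sval mu C < a%:E]).
    exact: eval_lt_open.
  by apply/seteqP; split=> mu /=; rewrite in_itv.
rewrite {1}eqK; apply: (@dynkin_induction _ (borel (M_ R r)) (@closed (M_ R r)) P) => //.
- exact: closedI.
- by apply: PC; exact: closedT.
- move=> S mS PS; rewrite /P.
  have E (mu : M_ R r.+1) : sval mu (~` S) = sval mu setT - sval mu S.
    rewrite -setTD measureD// ?setTI//.
    by rewrite -ge0_fin_numE// measures_fin.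
  under eq_fun do rewrite E.
  by apply: emeasurable_funB => //; apply: PC; exact: closedT.
- move=> F mF tF PF; rewrite /P.
  under eq_fun do rewrite measure_bigcup//.
  rewrite (_ : (fun _ => _) = (fun mu : borel (M_ R r.+1) =>
      \sum_(0 <= i <oo | i \in xpredT) sval mu (F i))); last first.
    by apply/funext => mu; apply: eq_eseriesl => i; rewrite mem_setT.
  by apply: ge0_emeasurable_sum => // k _; exact: PF.
Qed.

Local Close Scope ereal_scope.

Section canonical_kernel.
Variable R : realType.

Lemma embM_measurable r :
  measurable_fun setT (@embM R r : borel (M_ R r) -> borel (M R)).
Proof. by apply: continuous_measurable_borel; exact: embM_continuous. Qed.

(** This takes the place of Kolmogorov's extension theorem. Transported to [M] by [embM r], the
    measure [coord r.+1 s] is already right on cylinders of level [k <= r]. A weak limit in [r] is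
    right at every level, since its law there satisfies both portmanteau inequalities against an
    eventually constant law. *)
Lemma extension_exists (s : M R) :
  exists nu : subprobability (borel (M R)) R,
    forall r (A : set (borel (M_ R r))), measurable A ->
      nu (cyl A) = sval (coord r.+1 s) A.
Proof.
have [U [UU ooU]] := ultraFilterLemma eventually_filter.
pose m r : subprobability (borel (M R)) R :=
  giry_map (@embM_measurable r) (sval (coord r.+1 s)).
have mE r k (A : set (borel (M_ R k))) : (k <= r)%N -> measurable A ->
    m r (cyl A) = sval (coord k.+1 s) A.
  move=> kr mA; rewrite -(@emb_coord R r.+1)//.
  by rewrite /emb/= trimE.
have nM : normal_space (M R).
  by apply: compact_normal; [exact: hausdorff_M|exact: compact_M].
have [nu nuP] := ultra_limit_measure m UU (@compact_M R) nM.
exists nu => k.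
pose nuk : measures (M_ R k) :=
  of_subprobability (giry_map (@coord_measurable R k) nu).
have nukE (A : set (borel (M_ R k))) : measurable A -> sval nuk A = nu (cyl A).
  by move=> mA; rewrite /nuk/= trimE.
suff <- : nuk = coord k.+1 s by move=> A /nukE.
have Uk : U [set i | (k <= i)%N] by apply: ooU; exists k.
apply/esym/measures_eq_portmanteau.
- move=> C cC; have mC := closed_measurable_borel cC; rewrite nukE//.
  apply/lee_addgt0Pr => e e0; have [+ _] := nuP e e0.
  have ccC : closed (cyl C) by apply: closed_comp => // x _; exact: coord_continuous.
  move=> /(_ _ ccC) h.
  have [i [/= ki]] := filter_ex (filterI Uk h).
  by rewrite mE.
- move=> V oV; have mV := open_measurable_borel oV; rewrite nukE//.
  apply/lee_addgt0Pr => e e0; have [_ +] := nuP e e0.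
  have ocV : open (cyl V) by apply: open_comp => // x _; exact: coord_continuous.
  move=> /(_ _ ocV) h.
  have [i [/= ki]] := filter_ex (filterI Uk h).
  by rewrite mE.
Qed.

Definition extension (s : M R) : {measure set (borel (M R)) -> \bar R} :=
  projT1 (cid (extension_exists s)).

Lemma extensionE (s : M R) r (A : set (borel (M_ R r))) : measurable A ->
  extension s (cyl A) = sval (coord r.+1 s) A.
Proof. by rewrite /extension; case: cid => /= nu h mA; exact: h. Qed.

Lemma extension_le1 (s : M R) : (extension s setT <= 1)%E.
Proof. by rewrite /extension; case: cid => nu ?; exact: sprobability_setT. Qed.

(** The measures are chosen separately for each [s], so measurability in [s] has to come from the
    cylinders, where their values are prescribed. *)
Lemma extension_measurable (A : set (borel (M R))) : measurable A ->
  measurable_fun setT ((extension^~ A) : borel (M R) -> \bar R).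
Proof.
have fin s B : measurable (B : set (borel (M R))) -> extension s B \is a fin_num.
  by rewrite /extension; case: cid => nu ? mB; exact: subprobability_fin.
have Pcyl r (B : set (borel (M_ R r))) : measurable B ->
    measurable_fun setT ((extension^~ (cyl B)) : borel (M R) -> \bar R).
  move=> mB; under eq_fun do rewrite extensionE//.
  apply: (measurableT_comp (eval_measurable mB)).
  exact: coord_measurable.
move: A; apply: cyls_ind => //.
- rewrite (_ : setT = @cyl R 0 setT); first exact: Pcyl.
  by apply/seteqP; split.
- move=> S mS PS.
  have E (s : M R) : extension s (~` S) = (extension s setT - extension s S)%E.
    by rewrite -setTD measureD// ?setTI// -ge0_fin_numE// fin.
  under eq_fun do rewrite E.
  apply: emeasurable_funB => //.
  rewrite (_ : setT = @cyl R 0 setT); first exact: Pcyl.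
  by apply/seteqP; split.
- move=> F mF tF PF.
  under eq_fun do rewrite measure_bigcup//.
  rewrite (_ : (fun _ => _) = (fun s : borel (M R) =>
      \sum_(0 <= i <oo | i \in xpredT) extension s (F i))%E); last first.
    by apply/funext => mu; apply: eq_eseriesl => i; rewrite mem_setT.
  by apply: ge0_emeasurable_sum => // k _; exact: PF.
Qed.

HB.instance Definition _ := isKernel.Build _ _ (borel (M R)) (borel (M R)) R
  (extension : borel (M R) -> _) extension_measurable.

Let extension_sup :
  (ereal_sup [set extension s [set: borel (M R)] | s in [set: M R]] <= 1)%E.
Proof. by apply: ge_ereal_sup => _ [s _ <-]; exact: extension_le1. Qed.

HB.instance Definition _ := Kernel_isSubProbability.Build _ _ (borel (M R)) (borel (M R)) R
  (extension : borel (M R) -> _) extension_sup.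

Lemma canonical_kernelP : Defs.canonical (canonical_kernel R).
Proof.
rewrite /canonical_kernel; case: pselect => [ex|[]]; first by case: cid.
exists (extension : R.-spker (borel (M R)) ~> (borel (M R))) => r A mA s.
exact: extensionE.
Qed.

End canonical_kernel.

(** * Monotone classes *)

Section step_polynomials.
Context {R : realType}.
Implicit Types (x t : R).

Lemma bernoulli_le x m : 0 <= x -> x <= 1 -> 1 - m%:R * x <= (1 - x) ^+ m.
Proof.
move=> x0 x1; elim: m => [|m IH]; first by rewrite mul0r subr0 expr0.
rewrite exprSr; apply: (@le_trans _ _ ((1 - m%:R * x) * (1 - x))).
  rewrite -natr1; have : 0 <= m%:R * x * x by rewrite !mulr_ge0.
  nra.
by rewrite ler_wpM2r// subr_ge0.
Qed.

(** The bound [(1 - x)^m <= 1 / (1 + m x)], cleared of its denominator. *)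
Lemma bernoulli_ge x m : 0 <= x -> x <= 1 -> (1 - x) ^+ m * (1 + m%:R * x) <= 1.
Proof.
move=> x0 x1; elim: m => [|m IH]; first by rewrite expr0 mul0r addr0 mul1r.
apply: le_trans IH; rewrite exprSr -mulrA ler_wpM2l ?exprn_ge0 ?subr_ge0//.
rewrite -natr1; have : 0 <= m%:R * x * x by rewrite !mulr_ge0.
nra.
Qed.

(* Converges to the indicator of [t < 1/2] on [0, 1]: [(1 - x)^m] is close to
   [1] or to [0] as [m x] is small or large, and here [m x = n (2t)^(2n)]. *)
Definition step_poly (n : nat) (t : R) : R :=
  (1 - t ^+ (n + n)) ^+ (n * 2 ^ (n + n)).

Lemma step_poly01 t n : 0 <= t <= 1 -> 0 <= step_poly n t <= 1.
Proof.
move=> /andP[t0 t1]; have h : 0 <= 1 - t ^+ (n + n) by rewrite subr_ge0 exprn_ile1.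
by rewrite exprn_ge0//= exprn_ile1// gerBl exprn_ge0.
Qed.

Lemma step_poly_cvg t : 0 <= t <= 1 ->
  (fun n => step_poly n t) @ \oo --> ((t < 2^-1)%R%:R : R).
Proof.
move=> /andP[t0 t1].
have x0 n : 0 <= t ^+ (n + n) by rewrite exprn_ge0.
have x1 n : t ^+ (n + n) <= 1 by rewrite exprn_ile1.
have mx n : (n * 2 ^ (n + n))%:R * t ^+ (n + n) = n%:R * ((2 * t) ^+ n * (2 * t) ^+ n).
  by rewrite natrM natrX -mulrA -exprMn -exprD.
have [t2|t2] := ltP t 2^-1; last first.
  (* For [t >= 1/2] one has [m x >= n], so the value is at most [1 / (n + 1)]. The boundary point
     [1/2] thus goes to [0], which makes the inequality in the limit strict. *)
  have h n : 0 <= step_poly n t <= harmonic n.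
    have /andP[s0 s1] := step_poly01 n (introT andP (conj t0 t1)).
    rewrite s0/= /harmonic -[leRHS]mul1r ler_pdivlMr//.
    apply: le_trans (bernoulli_ge (n * 2 ^ (n + n)) (x0 n) (x1 n)).
    rewrite ler_wpM2l// -natr1 addrC lerD2l mx -[leLHS]mulr1 ler_wpM2l//.
    have : 1 <= 2 * t by rewrite -ler_pdivrMl// mulr1.
    by move=> h; rewrite -exprD exprn_ege1.
  apply: (squeeze_cvgr (f := cst 0) (h := @harmonic R)); last exact: cvg_harmonic.
    by apply: nearW => n; exact: h.
  exact: cvg_cst.
have y0 : 0 <= 2 * t by rewrite mulr_ge0.
have y1 : 2 * t < 1 by rewrite -ltr_pdivlMl// mulr1.
have z0 : 0 < 1 - 2 * t by rewrite subr_gt0.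
(* The exponent [n + n] supplies two factors [(2t)^n]: one absorbs [n], as
   [n (2t)^n <= 1 / (1 - 2t)] by [bernoulli_ge] at [1 - 2t], and the other tends to [0]. *)
have h n : 1 - (1 - 2 * t)^-1 * (2 * t) ^+ n <= step_poly n t <= 1.
  have /andP[s0 ->] := step_poly01 n (introT andP (conj t0 t1)).
  rewrite andbT; apply: le_trans (bernoulli_le (n * 2 ^ (n + n)) (x0 n) (x1 n)).
  rewrite lerD2l lerN2 mx mulrA ler_wpM2r ?exprn_ge0//.
  rewrite -[leRHS]mulr1 ler_pdivlMl//.
  have := @bernoulli_ge (1 - 2 * t) n (ltW z0).
  rewrite subKr gerBl => /(_ y0) h; apply: le_trans h.
  rewrite mulrDr mulr1; have := exprn_ge0 n y0; nra.
apply: (squeeze_cvgr (f := fun n => 1 - (1 - 2 * t)^-1 * (2 * t) ^+ n) (h := cst 1)).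
- by apply: nearW => n; exact: h.
- rewrite -[X in _ --> X]subr0; apply: cvgB; first exact: cvg_cst.
  rewrite -(mulr0 (1 - 2 * t)^-1); apply: cvgM; first exact: cvg_cst.
  by apply: cvg_expr; rewrite ger0_norm.
- exact: cvg_cst.
Qed.

End step_polynomials.

Section monotone_class.
Context {R : realType} {T : pointedType}.
Implicit Types (P Q : (T -> R) -> Prop) (f g : T -> R).

(** Limits are those of arbitrary pointwise convergent [[0, 1]]-valued sequences, the kind that step
    polynomials produce; dominated convergence lets classes defined by integral identities satisfy
    this. *)
Definition mono_class P : Prop :=
  [/\ (forall f g, P f -> P g -> P (fun x => f x + g x)),
      (forall c f, P f -> P (fun x => c * f x)) &
      (forall (F : nat -> T -> R) f, (forall n, P (F n)) ->
         (forall n x, 0 <= F n x <= 1) ->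
         (forall x, F ^~ x @ \oo --> f x) -> P f)].

Definition multiplicative Q : Prop :=
  [/\ Q (fun=> 1), (forall f g, Q f -> Q g -> Q (fun x => f x * g x)) &
      (forall f x, Q f -> 0 <= f x <= 1)].

Inductive span Q : (T -> R) -> Prop :=
| span_base f : Q f -> span Q f
| span_add f g : span Q f -> span Q g -> span Q (fun x => f x + g x)
| span_scale c f : span Q f -> span Q (fun x => c * f x).

Lemma span_mono P Q f : mono_class P -> (forall g, Q g -> P g) -> span Q f -> P f.
Proof.
move=> [PD PZ _] QP; elim=> [g /QP//|g h _ Pg _ Ph|c g _ Pg].
  exact: PD.
exact: PZ.
Qed.

Lemma mono_class_sub P f g : mono_class P -> P f -> P g -> P (fun x => f x - g x).
Proof.
move=> [PD PZ _] Pf Pg; rewrite (_ : (fun x => _) = (fun x => f x + (-1) * g x)).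
  by apply: PD => //; exact: PZ.
by apply/funext => x; rewrite mulN1r.
Qed.

Lemma mono_class_setC P (S : set T) : mono_class P -> P (fun=> 1) ->
  P (\1_S) -> P (\1_(~` S)).
Proof.
move=> Pm P1 PS; rewrite (_ : \1_(~` S) = (fun x => 1 - \1_S x)).
  exact: mono_class_sub.
by apply/funext => x; rewrite !indicE in_setC; case: (_ \in _); rewrite /= (subr0, subrr).
Qed.

Lemma mono_class_bigcup P (F : (set T)^nat) : mono_class P -> P (fun=> 1) ->
  trivIset setT F -> (forall n, P (\1_(F n))) -> P (\1_(\bigcup_n F n)).
Proof.
move=> Pm P1 tF PF; have [PD _ PL] := Pm.
pose S n x : R := \sum_(i < n) \1_(F i) x.
have SE x k : F k x -> forall n, S n x = (k < n)%:R.
  move=> Fkx n; rewrite /S; have E i : \1_(F i) x = (i == k)%:R :> R.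
    rewrite indicE; congr (_%:R); congr nat_of_bool; apply/idP/eqP => [|->].
      rewrite inE => Fix; apply: (tF i k) => //; by exists x.
    by rewrite inE.
  have [kn|nk] := ltnP k n.
    rewrite (bigD1 (Ordinal kn))//= E eqxx big1 ?addr0// => i.
    by rewrite -val_eqE/= E => /negbTE ->.
  by rewrite big1// => i _; rewrite E ltn_eqF// (leq_trans (ltn_ord i)).
have S0 x : ~ (\bigcup_n F n) x -> forall n, S n x = 0.
  move=> nF n; rewrite /S big1// => i _; rewrite indicE memNset// => Fix.
  by apply: nF; exists i.
apply: (PL S) => [n|n x|x].
+ rewrite /S; elim: n => [|n IH].
    under eq_fun do rewrite big_ord0.
    by rewrite (_ : (fun=> 0) = (fun=> 1 - 1)); [exact: mono_class_sub|rewrite subrr].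
  under eq_fun do rewrite big_ord_recr/=.
  exact: PD.
+ have [[k _ Fkx]|/S0 ->] := pselect ((\bigcup_n F n) x); last by rewrite lexx ler01.
  by rewrite (SE _ _ Fkx); case: (_ < _)%N; rewrite ?lexx ?ler01.
+ have [Fx|nFx] := pselect ((\bigcup_n F n) x).
    rewrite indicE mem_set//; have [k _ Fkx] := Fx.
    apply: cvg_near_cst; exists k.+1 => // n /= kn.
    by rewrite (SE _ _ Fkx) kn.
  rewrite indicE memNset//; apply: cvg_near_cst; apply: nearW => n.
  exact: S0.
Qed.

Section span.
Context Q (Qm : multiplicative Q).

Lemma span_mul f g : span Q f -> span Q g -> span Q (fun x => f x * g x).
Proof.
move=> sf sg; elim: sf => [{}f Qf|f1 f2 _ s1 _ s2|c f1 _ s1].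
- elim: sg => [{}g Qg|g1 g2 _ s1 _ s2|c g1 _ s1].
  + by apply: span_base; case: Qm => _ QM _; exact: QM.
  + by under eq_fun do rewrite mulrDr; exact: span_add.
  + by under eq_fun do rewrite mulrCA; exact: span_scale.
- by under eq_fun do rewrite mulrDl; exact: span_add.
- by under eq_fun do rewrite -mulrA; exact: span_scale.
Qed.

Lemma span_cst c : span Q (fun=> c).
Proof.
rewrite (_ : (fun=> c) = (fun x : T => c * 1)); last by apply/funext => x; rewrite mulr1.
by apply/span_scale/span_base; case: Qm.
Qed.

Lemma span_exp f n : span Q f -> span Q (fun x => f x ^+ n).
Proof.
move=> sf; elim: n => [|n IH].
  by under eq_fun do rewrite expr0; exact: span_cst.
by under eq_fun do rewrite exprS; exact: span_mul.
Qed.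

Lemma span_sub f g : span Q f -> span Q g -> span Q (fun x => f x - g x).
Proof.
move=> sf sg; rewrite (_ : (fun x => _) = (fun x => f x + (-1) * g x)).
  by apply: span_add => //; exact: span_scale.
by apply/funext => x; rewrite mulN1r.
Qed.

Lemma span_step f n : span Q f -> span Q (fun x => step_poly n (f x)).
Proof.
by move=> sf; apply/span_exp/span_sub; [exact: span_cst|exact: span_exp].
Qed.

(** Sublevel sets of functions in the span need not be closed under intersection. These sets are, by
    multiplying the approximating sequences, and so form a pi-system for Dynkin's theorem. *)
Definition approx_set (A : set T) : Prop := exists F : nat -> T -> R,
  [/\ (forall n, span Q (F n)), (forall n x, 0 <= F n x <= 1) &
      (forall x, F ^~ x @ \oo --> (\1_A x : R))].

Lemma setI_closed_approx : setI_closed approx_set.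
Proof.
move=> A B [F [sF F01 FA]] [G [sG G01 GB]].
exists (fun n x => F n x * G n x); split=> [n|n x|x].
- exact: span_mul.
- have /andP[? ?] := F01 n x; have /andP[? ?] := G01 n x.
  by rewrite mulr_ge0//= mulr_ile1.
- by rewrite indicI; apply: cvgM; [exact: FA|exact: GB].
Qed.

Lemma approx_lt f : span Q f -> (forall x, 0 <= f x <= 1) ->
  approx_set [set x | f x < 2^-1].
Proof.
move=> sf f01; exists (fun n x => step_poly n (f x)); split=> [n|n x|x].
- exact: span_step.
- exact: step_poly01.
- rewrite indicE; have := step_poly_cvg (f01 x).
  by rewrite (_ : (x \in _) = (f x < 2^-1))//; apply/idP/idP; rewrite inE.
Qed.

Lemma monotone_class P (A : set T) : mono_class P -> (forall f, Q f -> P f) ->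
  <<s approx_set >> A -> P (\1_A).
Proof.
move=> Pm QP; have P1 : P (fun=> 1) by apply: QP; case: Qm.
apply: (@dynkin_induction _ (g_sigma_algebraType approx_set) _ (fun A => P (\1_A))) => //.
- exact: setI_closed_approx.
- by rewrite indicT.
- move=> B [F [sF F01 FB]]; have [_ _ PL] := Pm; apply: (PL F) => // n.
  exact: span_mono Pm QP (sF n).
- by move=> S _; exact: mono_class_setC.
- by move=> F _; exact: mono_class_bigcup.
Qed.

End span.
End monotone_class.

Section separation.
Context {R : realType} {K : pmetricType R} (Q : (K -> R) -> Prop).
Context (cptK : compact [set: K]) (Qm : multiplicative Q).
Context (Qc : forall f, Q f -> continuous f).
Context (Qsep : forall x y : K, x <> y -> exists2 f, Q f & f x <> f y).

Let span_continuous f : span Q f -> continuous f.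
Proof.
elim=> {f} [f /Qc//|f g _ cf _ cg x|c f _ cf x].
  by apply: cvgD; [exact: cf|exact: cg].
by apply: cvgM; [exact: cvg_cst|exact: cf].
Qed.

Let separator (x y : K) : x <> y -> exists g : K -> R,
  [/\ span Q g, forall z, 0 <= g z <= 1, g x < 2^-1 & 2^-1 < g y].
Proof.
move=> /Qsep[f Qf fxy]; pose d := f x - f y.
have d0 : 0 < d ^+ 2.
  by rewrite exprn_even_gt0//= subr_eq0; exact/eqP.
have f01 z : 0 <= f z <= 1 by case: Qm => _ _; apply.
(* The square makes the sign of [d] irrelevant. The values at [y] and [x] are [1/2 + d^2/4] and
   [1/2 - d^2/4], and the range stays in [[0, 1]] because [f] takes values there. *)
exists (fun z => 2^-1 * ((1 + d ^+ 2 / 2) - (f z - f y) ^+ 2)).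
split.
- apply: span_scale; apply: span_sub => //; first exact: span_cst.
  apply: span_exp => //; apply: span_sub => //; first exact: span_base.
  exact: span_cst.
- move=> z; have /andP[? ?] := f01 z; have /andP[? ?] := f01 y.
  have /andP[? ?] := f01 x; rewrite /d.
  have : (f z - f y) ^+ 2 <= 1 by rewrite expr2; nra.
  have : (f x - f y) ^+ 2 <= 1 by rewrite expr2; nra.
  have := sqr_ge0 (f z - f y); have := sqr_ge0 (f x - f y); lra.
- by rewrite -/d; lra.
- by rewrite subrr expr0n/=; lra.
Qed.

Local Notation smeas A := (@measurable _ (g_sigma_algebraType (approx_set Q)) A).

Let local_separation (x : K) (U : set K) : open U -> U x ->
  exists W : set K, [/\ smeas W, nbhs x W & W `<=` U].
Proof.
move=> oU Ux.
have [g gP] : {g : K -> K -> R & forall y, ~ U y ->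
   [/\ span Q (g y), forall z, 0 <= g y z <= 1, g y x < 2^-1 & 2^-1 < g y y]}.
  apply: (@choice _ _ (fun y g => ~ U y ->
    [/\ span Q g, forall z, 0 <= g z <= 1, g x < 2^-1 & 2^-1 < g y])) => y.
  have [Uy|nUy] := pselect (U y); first by exists (fun=> 0).
  have [|g gP] := @separator x y; first by move=> xy; apply: nUy; rewrite -xy.
  by exists g.
have cU : compact (~` U).
  by apply: (subclosed_compact _ cptK) => //; exact: open_closedC.
move: cU; rewrite compact_cover.
move=> /(_ K (~` U) (fun y => g y @^-1` [set t | 2^-1 < t]))[].
- move=> y nUy; apply: open_comp; last exact: open_gt.
  by move=> z _; apply: span_continuous; have [] := gP y nUy.
- by move=> y nUy; exists y => //=; have [] := gP y nUy.
move=> D DU UD.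
have DP y : [set` D] y -> [/\ span Q (g y), forall z, 0 <= g y z <= 1,
    g y x < 2^-1 & 2^-1 < g y y].
  by move=> /DU; rewrite inE => /gP.
exists (\bigcap_(y in [set` D]) [set z | g y z < 2^-1]); split.
- apply: (@fin_bigcap_measurable _ (g_sigma_algebraType (approx_set Q))) => // y yD.
  by apply: sub_sigma_algebra; apply: approx_lt => //; have [] := DP y yD.
- apply: filter_bigI => y yD; have [sg _ gx _] := DP y yD.
  exact: (span_continuous sg (open_nbhs_nbhs (conj (@open_lt _ _) gx))).
- move=> z Wz; apply: contrapT => /UD[y yD /=].
  by have /= := Wz y yD => /lt_trans /[apply]; rewrite ltxx.
Qed.

Let closed_separation (C U : set K) : closed C -> open U -> C `<=` U ->
  exists W : set K, [/\ smeas W, C `<=` W & W `<=` U].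
Proof.
move=> cC oU CU.
have [W WP] : {W : K -> set K & forall x, C x ->
    [/\ smeas (W x), nbhs x (W x) & W x `<=` U]}.
  apply: (@choice _ _ (fun x W => C x -> [/\ smeas W, nbhs x W & W `<=` U])) => x.
  have [Cx|nCx] := pselect (C x); last by exists set0.
  by have [W WP] := local_separation oU (CU x Cx); exists W.
have : compact C by apply: (subclosed_compact _ cptK).
rewrite compact_cover => /(_ K C (fun x => (W x)°))[].
- by move=> x _; exact: open_interior.
- by move=> x Cx; exists x => //; have [] := WP x Cx.
move=> D DC CD.
have DP x : [set` D] x -> [/\ smeas (W x), nbhs x (W x) & W x `<=` U].
  by move=> /DC; rewrite inE => /WP.
exists (\bigcup_(x in [set` D]) W x); split.
- apply: (@fin_bigcup_measurable _ (g_sigma_algebraType (approx_set Q))) => // x xD.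
  by have [] := DP x xD.
- by move=> z /CD[x xD /interior_subset ?]; exists x.
- by move=> z [x xD]; have [_ _] := DP x xD; exact.
Qed.

(** Compactness upgrades separation of points first to neighbourhoods of a point, then to closed
    sets inside open ones. A closed set is then a countable intersection of generated sets squeezed
    between it and its thickenings. *)
Lemma separating_borel (A : set (borel K)) : measurable A -> smeas A.
Proof.
have closed_smeas (C : set K) : closed C -> smeas C.
  move=> cC.
  have [W WP] : {W : nat -> set K & forall n,
      [/\ smeas (W n), C `<=` W n & W n `<=` thickening C n.+1%:R^-1]}.
    apply: (@choice _ _ (fun n W => [/\ smeas W, C `<=` W &
      W `<=` thickening C n.+1%:R^-1])) => n.
    apply: closed_separation => //; first exact: thickening_open.
    by apply: sub_thickening; rewrite invr_gt0.
  have -> : C = \bigcap_n W n.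
    apply/seteqP; split=> [x Cx n _|x Wx]; first by have [_ h _] := WP n; exact: h.
    rewrite -(bigcap_thickening cC) => n _; have [_ _ h] := WP n.
    exact: (h x (Wx n I)).
  apply: (@bigcapT_measurable _ (g_sigma_algebraType (approx_set Q))) => n.
  by have [] := WP n.
apply: smallest_sub; first exact: sigma_algebra_measurable.
move=> O oO; rewrite -(setCK O).
apply: (@measurableC _ (g_sigma_algebraType (approx_set Q))).
by apply: closed_smeas; exact: open_closedC.
Qed.

End separation.

(** * Integrals of bounded functions *)

Section bounded_integral.
Context d (T : measurableType d) (R : realType).
Implicit Types (f g : T -> R) (mu : subprobability T R).

Definition bmf f : Prop := measurable_fun setT f /\ exists B, forall x, `|f x| <= B.

Lemma bmf_cst c : bmf (fun=> c).
Proof. by split; [exact: measurable_cst|exists `|c|]. Qed.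

Lemma bmf_add f g : bmf f -> bmf g -> bmf (fun x => f x + g x).
Proof.
move=> [mf [B fB]] [mg [C gC]]; split; first exact: measurable_funD.
by exists (B + C) => x; rewrite (le_trans (ler_normD _ _))// lerD.
Qed.

Lemma bmf_mul f g : bmf f -> bmf g -> bmf (fun x => f x * g x).
Proof.
move=> [mf [B fB]] [mg [C gC]]; split; first exact: measurable_funM.
by exists (B * C) => x; rewrite normrM ler_pM.
Qed.

Lemma bmf_scale c f : bmf f -> bmf (fun x => c * f x).
Proof. by apply: bmf_mul; exact: bmf_cst. Qed.

Lemma bmf_itv f a b : measurable_fun setT f -> (forall x, a <= f x <= b) -> bmf f.
Proof.
move=> mf fab; split=> //; exists (`|a| + `|b|) => x.
have /andP[ax xb] := fab x.
have := ler_norm b; have := ler_norm (- a); rewrite normrN.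
have := normr_ge0 a; have := normr_ge0 b.
rewrite ler_norml; lra.
Qed.

Lemma bmf_indic A : measurable A -> bmf (\1_A).
Proof.
move=> mA; apply: (@bmf_itv _ 0 1); first exact: measurable_indic.
by move=> x; rewrite indicE; case: (_ \in _); rewrite ?lexx ?ler01.
Qed.

Lemma bmf_integrable mu f : bmf f -> mu.-integrable setT (EFin \o f).
Proof.
move=> [mf [B fB]]; apply: measurable_bounded_integrable => //.
  by rewrite -ge0_fin_numE// subprobability_fin.
exists B; split; first exact: num_real.
by move=> M BM x _; exact: le_trans (fB x) (ltW BM).
Qed.

Lemma bint_add mu f g : bmf f -> bmf g ->
  \int[mu]_x (f x + g x) = \int[mu]_x f x + \int[mu]_x g x.
Proof. by move=> bf bg; rewrite RintegralD//; exact: bmf_integrable. Qed.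

Lemma bint_scale mu c f : bmf f ->
  \int[mu]_x (c * f x) = c * \int[mu]_x f x.
Proof. by move=> bf; rewrite RintegralZl//; exact: bmf_integrable. Qed.

Lemma bint_le mu f g : bmf f -> bmf g -> (forall x, f x <= g x) ->
  \int[mu]_x f x <= \int[mu]_x g x.
Proof. by move=> bf bg fg; apply: le_Rintegral => //; exact: bmf_integrable. Qed.

Lemma bint_indic mu A : measurable A -> \int[mu]_x \1_A x = fine (mu A).
Proof. by move=> mA; rewrite /Rintegral integral_indic// setIT. Qed.

Lemma bint_EFin mu f : bmf f ->
  (\int[mu]_x (f x)%:E)%E = (\int[mu]_x f x)%:E.
Proof.
move=> bf; rewrite /Rintegral fineK//; apply: integrable_fin_num => //.
exact: bmf_integrable.
Qed.

Lemma bint01 mu f : bmf f -> (forall x, 0 <= f x <= 1) ->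
  0 <= \int[mu]_x f x <= 1.
Proof.
move=> bf f01; rewrite Rintegral_ge0/=; last by move=> x _; have /andP[] := f01 x.
apply: (@le_trans _ _ (\int[mu]_x \1_setT x)).
  apply: bint_le => //; first exact: bmf_indic.
  by move=> x; rewrite indicT; have /andP[] := f01 x.
by rewrite bint_indic//; have /andP[] := subprobability_fine01 mu measurableT.
Qed.

Lemma bmf_lim (F : nat -> T -> R) f : (forall n, bmf (F n)) ->
  (forall n x, 0 <= F n x <= 1) -> (forall x, F ^~ x @ \oo --> f x) -> bmf f.
Proof.
move=> bF F01 Ff; apply: (@bmf_itv _ 0 1).
  by apply: (measurable_fun_cvg (h := F)) => [n|x _]; [case: (bF n)|exact: Ff].
move=> x; apply/andP; split.
  by apply: (cvgr_to_ge (Ff x)); apply: nearW => n; have /andP[] := F01 n x.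
by apply: (cvgr_to_le (Ff x)); apply: nearW => n; have /andP[] := F01 n x.
Qed.

Lemma bint_lim mu (F : nat -> T -> R) f : (forall n, bmf (F n)) ->
  (forall n x, 0 <= F n x <= 1) -> (forall x, F ^~ x @ \oo --> f x) ->
  (fun n => \int[mu]_x F n x) @ \oo --> \int[mu]_x f x.
Proof.
move=> bF F01 Ff; have bf := bmf_lim bF F01 Ff.
apply: fine_cvg; rewrite -/(Rintegral _ _ _) -bint_EFin//.
apply: (@dominated_cvg _ _ _ mu setT _ (fun n x => (F n x)%:E) (EFin \o f)
  (cst 1%E)) => //.
- by move=> n; apply/measurable_EFinP; case: (bF n).
- by move=> x _; apply: cvg_EFin; [exact: nearW|exact: Ff].
- by have := bmf_integrable mu (bmf_cst 1).
- move=> n x _; rewrite lee_fin.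
  by have /andP[? ?] := F01 n x; rewrite ger0_norm.
Qed.

End bounded_integral.

Section layer_cake.
Context {R : realType}.

(** Rounding down with error at most [1/N], written as an average of indicators of superlevel sets.
    It passes from sets to functions in monotone classes and in Levy-Prokhorov estimates. *)
Definition layers (N : nat) (t : R) : R :=
  N%:R^-1 * \sum_(k < N) (k.+1%:R < N%:R * t)%R%:R.

Let count_layers (N : nat) (u : R) : 0 <= u -> u <= N%:R ->
  \sum_(k < N) (k.+1%:R < u)%R%:R <= u <= \sum_(k < N) (k.+1%:R < u)%R%:R + 1.
Proof.
move=> u0; elim: N => [|N IH] uN.
  by rewrite big_ord0 u0/=; move: uN; lra.
rewrite big_ord_recr/=; have [uN'|Nu] := leP u N%:R.
  have /andP[h1 h2] := IH uN'.
  have -> : (N.+1%:R < u) = false.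
    by apply/negbTE; rewrite -leNgt (le_trans uN')// ler_nat.
  by rewrite addr0 h1.
rewrite (eq_bigr (fun=> 1)); last first.
  by move=> k _; rewrite (le_lt_trans _ Nu)// ler_nat.
rewrite sumr_const card_ord; case: ltP => h /=; move: uN Nu h; rewrite -!natr1; lra.
Qed.

Lemma layers_bounds N t : (0 < N)%N -> 0 <= t <= 1 ->
  layers N t <= t <= layers N t + N%:R^-1.
Proof.
move=> N0 /andP[t0 t1]; have N0' : 0 < N%:R :> R by rewrite ltr0n.
have /andP[h1 h2] : \sum_(k < N) (k.+1%:R < N%:R * t)%R%:R <= N%:R * t <=
    \sum_(k < N) (k.+1%:R < N%:R * t)%R%:R + 1.
  apply: count_layers; first by rewrite mulr_ge0.
  by rewrite -[leRHS]mulr1 ler_wpM2l.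
by rewrite /layers ler_pdivrMl// h1/= -[X in _ + X]mulr1 -mulrDr ler_pdivlMl.
Qed.

Lemma layers01 N t : 0 <= layers N t <= 1.
Proof.
rewrite /layers; apply/andP; split; first by rewrite mulr_ge0// sumr_ge0.
case: N => [|N]; first by rewrite big_ord0 mulr0.
rewrite ler_pdivrMl// mulr1 (@le_trans _ _ (\sum_(k < N.+1) 1))//.
  by apply: ler_sum => k _; rewrite lern1 leq_b1.
by rewrite sumr_const card_ord.
Qed.

Lemma layers_cvg t : 0 <= t <= 1 -> (fun n => layers n.+1 t) @ \oo --> t.
Proof.
move=> t01; apply: (squeeze_cvgr (f := fun n => t - harmonic n) (h := cst t)).
- apply: nearW => n; have /andP[h1 h2] := layers_bounds (ltn0Sn n) t01.
  by rewrite h1 andbT lerBlDr.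
- by rewrite -[X in _ --> X]subr0; apply: cvgB; [exact: cvg_cst|exact: cvg_harmonic].
- exact: cvg_cst.
Qed.

Lemma layersE {T : Type} N (f : T -> R) x : layers N (f x) =
  N%:R^-1 * \sum_(k < N) \1_[set x | k.+1%:R < N%:R * f x] x.
Proof.
rewrite /layers; congr (_ * _); apply: eq_bigr => k _.
by rewrite indicE; congr (_%:R); congr nat_of_bool; apply/idP/idP; rewrite inE.
Qed.

Lemma superlevel_measurable d (T : measurableType d) (f : T -> R) (a c : R) :
  measurable_fun setT f -> measurable [set x | a < c * f x].
Proof.
move=> mf; have mcf : measurable_fun setT (fun x => c * f x) by exact: measurable_funM.
have := measurable_fun_ltr (measurable_cst a) mcf measurableT (Y := [set true]) I.
by rewrite setTI.
Qed.

Lemma mono_class_measurable d (T : measurableType d) (P : (T -> R) -> Prop) :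
  mono_class P -> (forall A, measurable A -> P (\1_A)) ->
  forall f : T -> R, measurable_fun setT f -> (forall x, 0 <= f x <= 1) -> P f.
Proof.
move=> [PD PZ PL] Pind f mf f01.
apply: (PL (fun n x => layers n.+1 (f x))) => [n|n x|x].
- under eq_fun do rewrite layersE.
  apply: PZ; move: (n.+1%:R) => c; elim: n.+1 => [|m IH].
    by under eq_fun do rewrite big_ord0; have := Pind set0 measurable0; rewrite indic0.
  under eq_fun do rewrite big_ord_recr/=; apply: PD => //; apply: Pind.
  exact: superlevel_measurable.
- exact: layers01.
- exact: layers_cvg.
Qed.

End layer_cake.

Section change_of_variables.
Context d (T : measurableType d) d' (T' : measurableType d') (R : realType).

Lemma bint_image (mu : subprobability T R) (nu : subprobability T' R)
    (phi : T -> T') (g : T' -> R) : measurable_fun setT phi ->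
  (forall A, measurable A -> nu A = mu (phi @^-1` A)) -> bmf g ->
  \int[nu]_y g y = \int[mu]_x g (phi x).
Proof.
move=> mphi numu bg.
have bgphi : bmf (g \o phi).
  have [mg [B gB]] := bg; split; last by exists B => x; exact: gB.
  exact: measurableT_comp.
rewrite /Rintegral; congr fine.
rewrite (@eq_measure_integral _ _ _ _ (pushforward mu phi)); last first.
  by move=> A mA _; exact: numu.
rewrite integral_pushforward//=.
- by case: bg => mg _; exact/measurable_EFinP.
- by rewrite preimage_setT; exact: (bmf_integrable mu bgphi).
Qed.

End change_of_variables.

Lemma mono_class_bint d (T : measurableType d) (R : realType)
    (mu nu : subprobability T R) :
  mono_class (fun h : T -> R => bmf h /\ \int[mu]_x h x = \int[nu]_x h x).
Proof.
split=> [f g [bf ef] [bg eg]|c f [bf ef]|F f PF F01 Ff].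
- by split; [exact: bmf_add|rewrite !bint_add// ef eg].
- by split; [exact: bmf_scale|rewrite !bint_scale// ef].
- have bF n : bmf (F n) by case: (PF n).
  split; first exact: bmf_lim bF F01 Ff.
  have h1 := @bint_lim _ _ _ mu _ _ bF F01 Ff; have h2 := @bint_lim _ _ _ nu _ _ bF F01 Ff.
  have E : (fun n => \int[nu]_x F n x) = (fun n => \int[mu]_x F n x).
    by apply/funext => n; case: (PF n).
  by move: h2; rewrite E => h2; exact: (cvg_unique _ h1 h2).
Qed.

(** * Uniform continuity of integration *)

Section uniform_continuity.
Context {R : realType} {K : pmetricType R}.

Definition uc (f : K -> R) : Prop := forall e, 0 < e ->
  exists2 del, 0 < del & forall x y, mdist x y < del -> `|f x - f y| < e.

Lemma uc_continuous (f : K -> R) : uc f -> continuous f.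
Proof.
move=> uf x; apply/cvgrPdist_lt => e /uf[del del0 h].
suff : nbhs x [set y | `|f x - f y| < e] by [].
by rewrite nbhs_mdist; exists del => // y; exact: h.
Qed.

Lemma uc_measurable (f : K -> R) : uc f -> measurable_fun setT (f : borel K -> R).
Proof.
move=> /uc_continuous cf; apply: (measurability _ (RGenOInfty.measurableE R)).
move=> _ /= [_ [a ->] <-]; rewrite setTI.
apply: open_measurable_borel; apply: open_comp; first by move=> x _; exact: cf.
exact: interval_open.
Qed.

Lemma uc_bmf (f : K -> R) : uc f -> (forall x, 0 <= f x <= 1) -> bmf (f : borel K -> R).
Proof. by move=> /uc_measurable mf f01; exact: bmf_itv mf f01. Qed.

Lemma uc_mul (f g : K -> R) : uc f -> uc g -> (forall x, 0 <= f x <= 1) ->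
  (forall x, 0 <= g x <= 1) -> uc (fun x => f x * g x).
Proof.
move=> uf ug f01 g01 e e0.
have e2 : 0 < e / 2 by rewrite divr_gt0.
have [d1 d10 h1] := uf _ e2; have [d2 d20 h2] := ug _ e2.
exists (Num.min d1 d2); first by rewrite lt_min d10.
move=> x y; rewrite lt_min => /andP[/h1 + /h2].
have /andP[? ?] := f01 x; have /andP[? ?] := f01 y.
have /andP[? ?] := g01 x; have /andP[? ?] := g01 y.
rewrite !ltr_norml => /andP[? ?] /andP[? ?].
have -> : f x * g x - f y * g y = (f x - f y) * g x + f y * (g x - g y) by ring.
apply/andP; split; nra.
Qed.

(** The distance compares masses of sets, and layers reduce [f] to its superlevel sets: a
    [del]-thickening of [S k.+1] stays inside [S k]. *)
Lemma uc_int (f : K -> R) : uc f -> (forall x, 0 <= f x <= 1) ->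
  forall e, 0 < e -> exists2 del, 0 < del &
    forall mu nu : measures K, mdist mu nu < del ->
      `|\int[sval mu]_x f x - \int[sval nu]_x f x| < e.
Proof.
move=> uf f01 e e0.
(* The error is [3/N]: one part for rounding [f], one for the additive error of the distance
   averaged over the layers, one for the shift by a layer. *)
pose N := (Num.trunc (3 / e)).+1.
have N0 : 0 < N%:R :> R by rewrite ltr0n.
have Ne : 3 * N%:R^-1 < e.
  rewrite ltr_pdivrMr// mulrC -ltr_pdivrMr//.
  by rewrite /N; apply: truncnS_gt.
have [del del0 fdel] := uf N%:R^-1 (ltac:(by rewrite invr_gt0)).
exists (Num.min del N%:R^-1); first by rewrite lt_min del0 invr_gt0.
have mf := uc_measurable uf.
have bf := uc_bmf uf f01.
pose S k : set (borel K) := [set x | k%:R < N%:R * f x].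
have mS k : measurable (S k) by exact: superlevel_measurable.
have bs m : bmf (fun x : borel K => \sum_(k < m) \1_(S k.+1) x : R).
  elim: m => [|m IH]; first by under eq_fun do rewrite big_ord0; exact: bmf_cst.
  by under eq_fun do rewrite big_ord_recr; apply: bmf_add => //; exact: bmf_indic.
have bS (mu : measures K) : \int[sval mu]_x layers N (f x) =
    N%:R^-1 * \sum_(k < N) fine (sval mu (S k.+1)).
  under eq_Rintegral do rewrite layersE.
  rewrite bint_scale//; congr (_ * _).
  suff E m : \int[sval mu]_x (\sum_(k < m) \1_(S k.+1) x : R) =
      \sum_(k < m) fine (sval mu (S k.+1)) by exact: E.
  elim: m => [|m IH].
    by under eq_Rintegral do rewrite big_ord0; rewrite Rintegral_cst// big_ord0 mul0r.
  under eq_Rintegral do rewrite big_ord_recr.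
  rewrite bint_add/=; [|exact: bs|exact: bmf_indic].
  by rewrite IH bint_indic// big_ord_recr.
have blay : bmf (fun x : borel K => layers N (f x)).
  under eq_fun do rewrite layersE.
  by apply: bmf_scale; exact: bs.
have half (mu1 mu2 : measures K) : mdist mu1 mu2 < Num.min del N%:R^-1 ->
    \int[sval mu1]_x f x <= \int[sval mu2]_x f x + 3 * N%:R^-1.
  move=> /levy_prokhorov_lt[_ munu].
  have le1 : \int[sval mu1]_x f x <=
      \int[sval mu1]_x layers N (f x) + N%:R^-1.
    apply: (@le_trans _ _ (\int[sval mu1]_x (layers N (f x) + N%:R^-1))).
      apply: bint_le => //; first by apply: bmf_add => //; exact: bmf_cst.
      by move=> x; have /andP[] := @layers_bounds R N (f x) isT (f01 x).
    rewrite bint_add//; last exact: bmf_cst.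
    rewrite lerD2l Rintegral_cst// ler_piMr ?invr_ge0//.
    by have /andP[] := subprobability_fine01 (sval mu1) measurableT.
  have le2 : \int[sval mu2]_x layers N (f x) <= \int[sval mu2]_x f x.
    apply: bint_le => // x.
    by have /andP[] := @layers_bounds R N (f x) isT (f01 x).
  have step k : fine (sval mu1 (S k.+1)) <= fine (sval mu2 (S k)) + N%:R^-1.
    have [h _] := munu _ (mS k.+1).
    have mT : measurable (thickening (S k.+1) (Num.min del N%:R^-1) : set (borel K)).
      exact: thickening_measurable.
    rewrite -lee_fin EFinD !fineK ?measures_fin//.
    apply: (le_trans h); apply: leeD; last by rewrite lee_fin ge_min lexx orbT.
    apply: le_sval => // y [x Sx]; rewrite lt_min => /andP[/fdel xy _].
    move: Sx xy; rewrite /S/= ltr_norml -natr1 => Sx /andP[_ xy].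
    have : N%:R * (f x - f y) < 1 by rewrite -ltr_pdivlMl// mulr1.
    by rewrite mulrBr; lra.
  have le3 : \int[sval mu1]_x layers N (f x) <=
      \int[sval mu2]_x layers N (f x) + 2 * N%:R^-1.
    rewrite !bS.
    have -> : 2 * N%:R^-1 = N%:R^-1 * (N%:R * N%:R^-1 + 1) :> R.
      by rewrite divff ?gt_eqF//; ring.
    rewrite -mulrDr ler_wpM2l ?invr_ge0//.
    apply: (@le_trans _ _ (\sum_(k < N) (fine (sval mu2 (S k)) + N%:R^-1))).
      by apply: ler_sum => k _; exact: step.
    rewrite big_split/= sumr_const card_ord -[N%:R^-1 *+ N]mulr_natl.
    (* The two sums differ by the mass of [S 0] minus that of [S N], hence by at most [1]. *)
    suff : \sum_(k < N) fine (sval mu2 (S k)) <=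
        \sum_(k < N) fine (sval mu2 (S k.+1)) + 1 by lra.
    have /andP[_ s1] := subprobability_fine01 (sval mu2) (mS 0%N).
    have /andP[s2 _] := subprobability_fine01 (sval mu2) (mS N).
    rewrite {1}/N big_ord_recl {2}/N big_ord_recr/=.
    rewrite (_ : \sum_(i < _) fine (sval mu2 (S (bump 0 i))) =
      \sum_(i < (Num.trunc (3 / e))) fine (sval mu2 (S i.+1)))//.
    by move: s1 s2; rewrite /N; lra.
  by move: le1 le2 le3; lra.
move=> mu nu munu; have h1 := half _ _ munu.
have := half nu mu; rewrite metric_sym => /(_ munu) h2.
by rewrite ltr_norml; move: h1 h2 Ne; lra.
Qed.

End uniform_continuity.

(** * Tree functions *)

Section test_functions.
Variable R : realType.

(* The tree functions of rooted trees of height at most [r]. *)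
Inductive treefun_ : forall r, (M_ R r -> R) -> Prop :=
| treefun__one r : treefun_ (fun=> 1 : R) (r := r)
| treefun__mul r (f g : M_ R r -> R) : treefun_ f -> treefun_ g ->
    treefun_ (fun x => f x * g x)
| treefun__int r (f : M_ R r -> R) : treefun_ f ->
    treefun_ (fun mu : M_ R r.+1 => \int[sval mu]_x f x).

Lemma treefun__uc01 r (f : M_ R r -> R) : treefun_ f -> uc f /\ (forall x, 0 <= f x <= 1).
Proof.
elim=> {r f} [r|r f g _ [uf f01] _ [ug g01]|r f _ [uf f01]].
- split=> [e e0|x]; last by rewrite ler01 lexx.
  by exists 1 => // x y _; rewrite subrr normr0.
- split; first exact: uc_mul.
  move=> x; have /andP[? ?] := f01 x; have /andP[? ?] := g01 x.
  by rewrite mulr_ge0//= mulr_ile1.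
- split; first exact: uc_int.
  by move=> mu; apply: bint01 => //; exact: uc_bmf.
Qed.

Lemma treefun__bmf r (f : M_ R r -> R) : treefun_ f -> bmf (f : borel (M_ R r) -> R).
Proof. by move=> /treefun__uc01[uf f01]; exact: uc_bmf. Qed.

(** Height at most [r] is height at most [r.+1]. The integral case is a change of variables, as each
    projection is the push-forward along the previous one. *)
Lemma treefun__proj r (f : M_ R r -> R) : treefun_ f ->
  treefun_ (fun x => f (sval (proj_ R r) x)).
Proof.
elim=> {r f} [r|r f g _ tf1 _ tg1|r f tff tf1]; first exact: treefun__one.
  exact: treefun__mul.
rewrite (_ : (fun x => _) = (fun mu : M_ R r.+2 =>
    \int[sval mu]_x f (sval (proj_ R r) x))); first exact: treefun__int.
apply/funext => mu /=.
apply: (@bint_image _ (borel (M_ R r.+1)) _ (borel (M_ R r)) _ (sval mu) _ (sval (proj_ R r))).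
- exact: unif_continuous_measurable (svalP (proj_ R r)).
- by move=> A mA; rewrite -(pushE (svalP (proj_ R r))).
- exact: treefun__bmf.
Qed.

Lemma treefun__multiplicative r : multiplicative (@treefun_ r).
Proof.
split; [exact: treefun__one|exact: treefun__mul|].
by move=> f x /treefun__uc01[].
Qed.

(** Two measures on [M_ r] that are not separated integrate all tree functions on [M_ r] alike;
    separation of points of [M_ r] then lets the monotone class argument identify them. *)
Lemma treefun__separates r (x y : M_ R r) : x <> y -> exists2 f, treefun_ f & f x <> f y.
Proof.
elim: r x y => [|r IH] mu nu; first by move=> /(_ (M_0_eq _ _)).
move=> munu; apply: contrapT => h; apply: munu.
have eqint f : treefun_ f -> \int[sval mu]_x f x = \int[sval nu]_x f x.
  move=> tff; apply: contrapT => ne; apply: h.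
  by exists (fun mu : M_ R r.+1 => \int[sval mu]_x f x) => //; exact: treefun__int.
apply: measures_eq => A mA.
have [||_] := @monotone_class R (borel (M_ R r)) _ (treefun__multiplicative r) _ A
    (mono_class_bint (sval mu) (sval nu)).
- by move=> f tff; split; [exact: treefun__bmf|exact: eqint].
- apply: (separating_borel (compact_M_ (R := R) (r := r)) (treefun__multiplicative r)) => //.
  by move=> f /treefun__uc01[/uc_continuous].
rewrite !bint_indic// => e; have := congr1 (@EFin R) e.
by rewrite !fineK ?measures_fin.
Qed.

Definition sdeg (s : M R) : subprobability (borel (M R)) R :=
  le1_measure (sprob_kernel_le1 (canonical_kernel R) s).

Lemma sdeg_cyl s r (A : set (borel (M_ R r))) : measurable A ->
  sdeg s (cyl A) = sval (coord r.+1 s) A.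
Proof. by move=> mA; exact: canonical_kernelP. Qed.

Lemma sdeg_coord s r (f : M_ R r -> R) : bmf (f : borel (M_ R r) -> R) ->
  \int[sdeg s]_x f (coord r x) = \int[sval (coord r.+1 s)]_y f y.
Proof.
move=> bf; apply/esym/(@bint_image _ (borel (M R)) _ (borel (M_ R r)) _ (sdeg s)).
- exact: coord_measurable.
- by move=> A mA; rewrite -sdeg_cyl.
- exact: bf.
Qed.

Definition treefun (g : M R -> R) : Prop :=
  exists r (f : M_ R r -> R), treefun_ f /\ g = fun s => f (coord r s).

Definition Dop (g : M R -> R) (s : M R) : R := \int[sdeg s]_x g x.

Lemma treefun__lift r k (f : M_ R r -> R) : (r <= k)%N -> treefun_ f ->
  exists2 h : M_ R k -> R, treefun_ h & forall s, h (coord k s) = f (coord r s).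
Proof.
move=> rk tff; rewrite -(subnK rk); elim: (k - r)%N => [|m [h th hE]].
  by rewrite add0n; exists f.
exists (fun x => h (sval (proj_ R _) x)); first exact: treefun__proj.
by move=> s; rewrite coordS hE.
Qed.

Lemma treefun1 : treefun (fun=> 1).
Proof. by exists 0%N, (fun=> 1); split=> //; exact: treefun__one. Qed.

Lemma treefun_mul f g : treefun f -> treefun g -> treefun (fun x => f x * g x).
Proof.
move=> [r [f' [tff ->]]] [k [g' [tgg ->]]].
have [f2 tf2 f2E] := treefun__lift (leq_maxl r k) tff.
have [g2 tg2 g2E] := treefun__lift (leq_maxr r k) tgg.
exists (maxn r k), (fun x => f2 x * g2 x); split; first exact: treefun__mul.
by apply/funext => s; rewrite f2E g2E.
Qed.

Lemma treefun_prod (I : Type) (s : seq I) (P : pred I) (f : I -> M R -> R) :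
  (forall i, P i -> treefun (f i)) -> treefun (fun x => \prod_(i <- s | P i) f i x).
Proof.
move=> Pf; elim: s => [|i s IH].
  by under eq_fun do rewrite big_nil; exact: treefun1.
case Pi: (P i); under eq_fun do rewrite big_cons Pi; last exact: IH.
by apply: treefun_mul => //; exact: Pf.
Qed.

Lemma treefun_D f : treefun f -> treefun (Dop f).
Proof.
move=> [r [f' [tff ->]]].
exists r.+1, (fun mu : M_ R r.+1 => \int[sval mu]_x f' x).
split; first exact: treefun__int.
by apply/funext => s; rewrite /Dop sdeg_coord//; exact: treefun__bmf.
Qed.

Lemma treefun01 f : treefun f -> forall x, 0 <= f x <= 1.
Proof. by move=> [r [f' [/treefun__uc01[_ f01] ->]]]. Qed.

Lemma treefun_continuous f : treefun f -> continuous f.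
Proof.
move=> [r [f' [/treefun__uc01[/uc_continuous cf _] ->]]] s.
by apply: continuous_comp; [exact: coord_continuous|exact: cf].
Qed.

Lemma treefun_bmf f : treefun f -> bmf (f : borel (M R) -> R).
Proof.
move=> [r [f' [tff ->]]]; have [mf [B fB]] := treefun__bmf tff.
split; last by exists B => s; exact: fB.
apply: (measurableT_comp mf); exact: coord_measurable.
Qed.

(** The separation argument is run on each metric space [M_ r]; cylinders carry the conclusion to
    [M]. *)
Lemma treefun_monotone_class (P : (borel (M R) -> R) -> Prop) :
  mono_class P -> (forall f, treefun f -> P f) ->
  forall A : set (borel (M R)), measurable A -> P (\1_A).
Proof.
move=> Pm TP; have P1 : P (fun=> 1) by exact/TP/treefun1.
have [PD PZ PL] := Pm.
apply: cyls_ind => [|r A mA|A _|F _].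
- by rewrite indicT.
- rewrite (_ : \1_(cyl A) = (fun s => \1_A (coord r s))); last first.
    by apply/funext => s; rewrite !indicE; congr (_%:R).
  apply: (@monotone_class R (borel (M_ R r)) _ (treefun__multiplicative r)
    (fun h => P (fun s => h (coord r s)))).
  + split=> [f g|c f|G f PG G01 Gf]; [exact: PD|exact: PZ|].
    by apply: (PL (fun n s => G n (coord r s))) => // s; exact: Gf.
  + by move=> f tff; apply: TP; exists r, f.
  + apply: (separating_borel (compact_M_ (R := R) (r := r)) (treefun__multiplicative r)) => //.
      by move=> f /treefun__uc01[/uc_continuous].
    exact: treefun__separates.
- exact: mono_class_setC.
- exact: mono_class_bigcup.
Qed.

Lemma treefun_determining (mu nu : subprobability (borel (M R)) R) :
  (forall f, treefun f -> \int[mu]_x f x = \int[nu]_x f x) ->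
  forall A : set (borel (M R)), measurable A -> mu A = nu A.
Proof.
move=> munu A mA.
have [|_] := treefun_monotone_class (mono_class_bint mu nu) _ mA.
  by move=> f Tf; split; [exact: treefun_bmf|exact: munu].
rewrite !bint_indic// => e; have := congr1 (@EFin R) e.
by rewrite !fineK ?subprobability_fin.
Qed.

End test_functions.

(** * Trees, walks and labelings *)

Section tree_walks.
Variables (R : realType) (F : sgraph).

(* The tree function of the part of a tree [F] behind [v] as seen from its
   neighbour [u], unfolded to depth [m]. *)
Fixpoint branch_ (m : nat) (u v : F) : M R -> R :=
  if m is m'.+1 then
    fun x => \prod_(w | adj v w && (w != u)) Dop (branch_ m' v w) x
  else fun=> 1.

Definition branch : F -> F -> M R -> R := branch_ #|F|.

(** A form of the rooted density that involves no labeling; [iterated_integral_rootval] identifies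
    the two. *)
Definition rootval (o : F) (x : M R) : R := \prod_(w | adj o w) Dop (branch o w) x.

Lemma branch__treefun m u v : treefun (branch_ m u v).
Proof.
elim: m u v => [|m IH] u v /=; first exact: treefun1.
by apply: treefun_prod => w _; apply: treefun_D.
Qed.

Lemma rootval_treefun o : treefun (rootval o).
Proof. by apply: treefun_prod => w _; apply/treefun_D/branch__treefun. Qed.

(* Non-backtracking walks in a tree do not repeat a node, so that unfolding to
   depth [#|F|] reaches all of them. *)
Lemma branch__stable m u v (s : seq F) : is_tree F ->
  path (@adj F) v (u :: s) -> uniq (v :: u :: s) -> (#|F| <= size s + m)%N ->
  branch_ m u v = branch_ m.+1 u v.
Proof.
move=> [_ _ acyc]; elim: m u v s => [|m IH] u v s pth unq cF.
  (* At depth [0] the walk would have [size s + 2] distinct nodes, more than [F] has. *)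
  have := max_card (mem (v :: u :: s)); rewrite (card_uniqP unq)/= => h.
  by exfalso; move: (leq_trans h cF); rewrite addn0; lia.
apply/funext => x; rewrite [LHS]/= [RHS]/=.
apply: eq_bigr => w /andP[vw wu]; congr (Dop _ x).
apply: (IH v w (u :: s)); last by rewrite /= addSnnS.
  by move: pth => /= ->; rewrite adj_sym vw.
rewrite /= in unq *; rewrite unq andbT !inE !negb_or wu.
have wv : w != v by apply: contraTneq vw => ->; rewrite adj_irrefl.
rewrite wv/=; apply/negP => ws.
case/splitPr: ws pth unq => s1 s2 pth unq.
(* A return to [w] closes a cycle with at least three nodes. *)
have /acyc : ucycle (@adj F) (v :: u :: rcons s1 w).
  rewrite /ucycle/=; apply/andP; split.
    move: pth => /= /andP[-> ]; rewrite cat_path rcons_path/= last_rcons rcons_path.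
    by move=> /and3P[-> -> _]; rewrite adj_sym.
  move: unq; rewrite -cat_rcons !mem_cat !inE cat_uniq !negb_or.
  rewrite [_ \in _ ++ _]mem_cat negb_or.
  by move=> /and5P[/and3P[-> -> _] /andP[-> _] -> _ _].
by rewrite /= size_rcons.
Qed.

(** Stability absorbs the level of depth that an unfolding costs, so [branch] satisfies its
    recursion exactly. *)
Lemma branchE u v : is_tree F -> adj u v ->
  branch u v = fun x => \prod_(w | adj v w && (w != u)) Dop (branch v w) x.
Proof.
move=> tF uv; rewrite [LHS](@branch__stable _ _ _ [::])//=.
- by rewrite adj_sym uv.
- by rewrite inE andbT; apply: contraTneq uv => ->; rewrite adj_irrefl.
Qed.

Lemma rootval_edge o o' : is_tree F -> adj o o' ->
  rootval o = fun x => branch o' o x * Dop (branch o o') x.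
Proof.
move=> tF oo'; apply/funext => x; rewrite /rootval (bigD1 o')//= mulrC.
by rewrite [in RHS]branchE// adj_sym.
Qed.

(** The labelings of the density on plain indices below [n], without ordinals or finite functions.
    It covers both the labeling picked for an arbitrary tree and the natural one of
    [parent_graph]. *)
Definition nlabeling (o : F) (n : nat) (l : nat -> F) (p : nat -> nat) : Prop :=
  [/\ (forall i j, (i < n)%N -> (j < n)%N -> l i = l j -> i = j),
      (forall v, exists2 i, (i < n)%N & l i = v),
      (0 < n)%N /\ l 0%N = o &
      (forall i, (0 < i)%N -> (i < n)%N -> (p i < i)%N /\
         forall j, (j < i)%N -> adj (l i) (l j) = (j == p i))].

Section nlabeling.
Variables (o : F) (n : nat) (l : nat -> F) (p : nat -> nat).
Context (lab : nlabeling o n l p).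

Lemma nlabeling_prod (S : comPzRingType) (Q : pred F) (f : F -> S) :
  \prod_(w | Q w) f w = \prod_(i < n | Q (l i)) f (l i).
Proof.
have [linj lsurj _ _] := lab.
rewrite (reindex (fun i : 'I_n => l i))//.
have [g gP] : {g : F -> 'I_n & forall v, l (g v) = v}.
  apply: (@choice _ _ (fun v (i : 'I_n) => l i = v)) => v.
  by have [i ilt <-] := lsurj v; exists (Ordinal ilt).
exists g => [i _|v _]; last exact: gP.
by apply: val_inj; apply: linj; [exact: ltn_ord|exact: ltn_ord|exact: (gP (l i))].
Qed.

Lemma nlabeling_children (S : comPzRingType) (Q : pred F) (f : F -> S) k :
  (k < n)%N -> (forall m, (m < n)%N -> k != m ->
     adj (l k) (l m) && Q (l m) = (k < m)%N && (p m == k)) ->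
  \prod_(w | adj (l k) w && Q w) f w = \prod_(k.+1 <= m < n | p m == k) f (l m).
Proof.
move=> kn h; rewrite nlabeling_prod big_geq_mkord; apply: eq_bigl => m.
have [->|km] := eqVneq k m; last by rewrite h// andbC.
by rewrite adj_irrefl ltnn andbF.
Qed.

Lemma nlabeling_child_adj k m : (m < n)%N -> (k < m)%N ->
  adj (l k) (l m) = (p m == k).
Proof.
move=> mn km; have [_ _ _ lp] := lab.
have [_ h] := lp m (leq_ltn_trans (leq0n _) km) mn.
by rewrite adj_sym h// eq_sym.
Qed.

Context (tF : is_tree F).

Lemma branch_nlabeling k : (0 < k)%N -> (k < n)%N ->
  branch (l (p k)) (l k) =
  fun x => \prod_(k.+1 <= m < n | p m == k) Dop (branch (l k) (l m)) x.
Proof.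
move=> k0 kn; have [linj _ _ lp] := lab; have [pk ladj] := lp k k0 kn.
have pkn := ltn_trans pk kn.
have lpk : adj (l (p k)) (l k) by rewrite adj_sym ladj.
rewrite branchE//; apply/funext => x.
apply: (@nlabeling_children _ (fun w => w != l (p k))
  (fun w => Dop (branch (l k) w) x)) => // m mn km.
have lE i : (i < n)%N -> (l i == l (p k)) = (i == p k).
  by move=> ilt; apply/eqP/eqP => [|->//]; exact: linj.
rewrite lE//; have [mk|mk|mk] := ltngtP k m.
- by rewrite nlabeling_child_adj// (gtn_eqF (ltn_trans pk mk)) andbT.
- by rewrite ladj// andbN.
- by rewrite mk eqxx in km.
Qed.

Lemma rootval_nlabeling : rootval o =
  fun x => \prod_(1 <= m < n | p m == 0%N) Dop (branch (l 0%N) (l m)) x.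
Proof.
have [linj _ [n0 <-] lp] := lab; apply/funext => x; rewrite /rootval.
have := @nlabeling_children _ predT (fun w => Dop (branch (l 0%N) w) x) 0%N n0.
under eq_bigl do rewrite andbT.
apply=> m mn m0; rewrite andbT lt0n eq_sym m0/= nlabeling_child_adj//.
by rewrite lt0n eq_sym.
Qed.

(** Once the nodes from [k] on are integrated out, each earlier node carries the branches towards
    its children among them. The induction peels variables from the innermost one. *)
Lemma iterated_integral_nlabeling k (xs : seq (M R)) : (0 < k)%N -> (k <= n)%N ->
  size xs = k ->
  iterated_integral (canonical_kernel R) [seq p i | i <- iota k (n - k)] xs =
  (\prod_(i < k) \prod_(k <= m < n | p m == i)
     Dop (branch (l i) (l m)) (nth point xs i))%:E.
Proof.
move=> k0 kn; rewrite -(subKn kn) in k0 *.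
elim: (n - k)%N xs k0 (leq_subr k n) => [|j IH] xs k0 jn sxs.
  rewrite subn0 subnn/= big1// => i _.
  by rewrite big_geq.
set k' := (n - j.+1)%N in k0 sxs *.
have k'n : (k' < n)%N by rewrite /k'; lia.
have jk' : (n - j)%N = k'.+1 by rewrite /k'; lia.
have -> : (n - k')%N = (n - k'.+1).+1 by lia.
have [_ _ _ lp] := lab; have [pk _] := lp k' k0 k'n.
rewrite [LHS]/=.
(* The new variable enters only through the branch [g] behind it; [c] collects the older variables.
   Integrating [g] gives the factor [m = k'] at the parent of [k']. *)
pose c := \prod_(i < k') \prod_(k'.+1 <= m < n | p m == i)
  Dop (branch (l i) (l m)) (nth point xs i).
pose g := branch (l (p k')) (l k').
have gT : bmf (g : borel (M R) -> R) by apply/treefun_bmf/branch__treefun.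
transitivity (\int[sdeg (nth point xs (p k'))]_x (c * g x)%:E)%E.
  apply: eq_integral => x _.
  have := IH (rcons xs x); rewrite jk' size_rcons sxs.
  move=> /(_ isT (ltnW jn) erefl) ->.
  congr (_%:E); rewrite big_ord_recr/= nth_rcons sxs ltnn eqxx; congr (_ * _).
    by apply: eq_bigr => i _; apply: eq_bigr => m _; rewrite nth_rcons sxs ltn_ord.
  by rewrite /g branch_nlabeling.
rewrite bint_EFin ?bint_scale//; last exact: bmf_scale.
congr (_%:E); rewrite -/(Dop g _) /c.
rewrite [RHS](eq_bigr (fun i : 'I_k' =>
  (if p k' == i then Dop (branch (l i) (l k')) (nth point xs i) else 1) *
  \prod_(k'.+1 <= m < n | p m == i) Dop (branch (l i) (l m)) (nth point xs i))); last first.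
  by move=> i _; rewrite big_ltn_cond//; case: ifP => //; rewrite mul1r.
rewrite big_split/= mulrC; congr (_ * _).
rewrite (bigD1 (Ordinal pk))//= eqxx big1 ?mulr1// => i.
by rewrite -val_eqE/= eq_sym => /negbTE ->.
Qed.

Lemma iterated_integral_rootval x :
  iterated_integral (canonical_kernel R) [seq p i | i <- iota 1 n.-1] [:: x] =
  (rootval o x)%:E.
Proof.
have [_ _ [n0 _] _] := lab.
by rewrite -subn1 iterated_integral_nlabeling// big_ord1 rootval_nlabeling.
Qed.

End nlabeling.
End tree_walks.

(** * Involution invariance *)

Section involution.
Variable R : realType.
Implicit Types (lam : probability (borel (M R)) R) (f g h : borel (M R) -> R).

Definition pairing lam g h := \int[lam]_x (g x * Dop h x).

Lemma Dop01 h x : bmf h -> (forall x, 0 <= h x <= 1) -> 0 <= Dop h x <= 1.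
Proof. exact: bint01. Qed.

(** Boundedness and measurability of [Dop h] belong to the class since the limit step applies
    dominated convergence twice, inside [Dop] and then in the outer integral. *)
Lemma mono_class_pairing lam g : bmf g -> bmf (Dop g : borel (M R) -> R) ->
  (forall x, 0 <= g x <= 1) -> (forall x, 0 <= Dop g x <= 1) ->
  mono_class (fun h => [/\ bmf h, bmf (Dop h : borel (M R) -> R) &
    pairing lam h g = pairing lam g h]).
Proof.
move=> bg bDg g01 Dg01.
have DD f h x : bmf f -> bmf h -> Dop (fun x => f x + h x) x = Dop f x + Dop h x.
  by move=> bf bh; rewrite /Dop bint_add.
have DZ c f x : bmf f -> Dop (fun x => c * f x) x = c * Dop f x.
  by move=> bf; rewrite /Dop bint_scale.
split=> [f h [bf bDf ef] [bh bDh eh]|c f [bf bDf ef]|F f PF F01 Ff].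
- split; first exact: bmf_add.
    rewrite (_ : Dop _ = fun x => Dop f x + Dop h x); first exact: bmf_add.
    by apply/funext => x; exact: DD.
  rewrite /pairing; under eq_Rintegral do rewrite mulrDl.
  under [in RHS]eq_Rintegral do rewrite DD// mulrDr.
  rewrite (bint_add _ (bmf_mul bf bDg) (bmf_mul bh bDg)).
  rewrite (bint_add _ (bmf_mul bg bDf) (bmf_mul bg bDh)).
  exact: (congr2 +%R ef eh).
- split; first exact: bmf_scale.
    rewrite (_ : Dop _ = fun x => c * Dop f x); first exact: bmf_scale.
    by apply/funext => x; exact: DZ.
  rewrite /pairing; under eq_Rintegral do rewrite -mulrA.
  under [in RHS]eq_Rintegral do rewrite DZ// mulrCA.
  rewrite (bint_scale _ c (bmf_mul bf bDg)) (bint_scale _ c (bmf_mul bg bDf)).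
  exact: (congr1 ( *%R c) ef).
- have bF n : bmf (F n) by have [] := PF n.
  have bDF n : bmf (Dop (F n) : borel (M R) -> R) by have [] := PF n.
  have DF01 n x : 0 <= Dop (F n) x <= 1 by exact: Dop01.
  have DFf x : (fun n => Dop (F n) x) @ \oo --> Dop f x by exact: bint_lim.
  split; [exact: bmf_lim bF F01 Ff|exact: bmf_lim bDF DF01 DFf|].
  have mul01 (a b : R) : 0 <= a <= 1 -> 0 <= b <= 1 -> 0 <= a * b <= 1.
    by move=> /andP[? ?] /andP[? ?]; rewrite mulr_ge0//= mulr_ile1.
  have h1 : (fun n => pairing lam (F n) g) @ \oo --> pairing lam f g.
    apply: bint_lim => [n|n x|x]; [exact: bmf_mul|exact: mul01|].
    by apply: cvgM; [exact: Ff|exact: cvg_cst].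
  have h2 : (fun n => pairing lam g (F n)) @ \oo --> pairing lam g f.
    apply: bint_lim => [n|n x|x]; [exact: bmf_mul|exact: mul01|].
    by apply: cvgM; [exact: cvg_cst|exact: DFf].
  have E : (fun n => pairing lam g (F n)) = (fun n => pairing lam (F n) g).
    by apply/funext => n; have [_ _ e] := PF n; exact: esym.
  by move: h2; rewrite E => h2; exact: (cvg_unique _ h1 h2).
Qed.

Lemma indic01 (A : set (borel (M R))) x : 0 <= (\1_A x : R) <= 1.
Proof. by rewrite indicE; case: (_ \in _); rewrite ?lexx ?ler01. Qed.

Lemma Dop_indic (A : set (borel (M R))) x : measurable A ->
  (Dop (\1_A) x)%:E = canonical_kernel R x A.
Proof.
move=> mA; rewrite /Dop bint_indic// fineK//.
exact: (subprobability_fin (sdeg x)).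
Qed.

Lemma bmf_Dop_indic (A : set (borel (M R))) : measurable A ->
  bmf (Dop (\1_A) : borel (M R) -> R).
Proof.
move=> mA; apply: (@bmf_itv _ _ _ _ 0 1); last first.
  by move=> x; apply: Dop01; [exact: bmf_indic|move=> y; exact: indic01].
apply/measurable_EFinP; rewrite (_ : _ \o _ = (canonical_kernel R)^~ A).
  exact: measurable_kernel.
by apply/funext => x /=; rewrite Dop_indic.
Qed.

Lemma pairing_indic lam (A B : set (borel (M R))) : measurable A -> measurable B ->
  (\int[lam]_(x in A) canonical_kernel R x B = (pairing lam (\1_A) (\1_B))%:E)%E.
Proof.
move=> mA mB; rewrite /pairing -bint_EFin; last first.
  by apply: bmf_mul; [exact: bmf_indic|exact: bmf_Dop_indic].
rewrite integral_mkcond; apply: eq_integral => x _.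
rewrite /patch indicE EFinM Dop_indic//.
by case: ifP; rewrite ?mul1e ?mul0e.
Qed.

Lemma mono_class_pairing_treefun lam (g : M R -> R) : treefun g ->
  mono_class (fun h => [/\ bmf h, bmf (Dop h : borel (M R) -> R) &
    pairing lam h g = pairing lam g h]).
Proof.
move=> Tg; have TDg := treefun_D Tg.
by apply: mono_class_pairing;
  [exact: treefun_bmf|exact: treefun_bmf|exact: treefun01|exact: treefun01].
Qed.

Lemma mono_class_pairing_indic lam (A : set (borel (M R))) : measurable A ->
  mono_class (fun h => [/\ bmf h, bmf (Dop h : borel (M R) -> R) &
    pairing lam h (\1_A) = pairing lam (\1_A) h]).
Proof.
move=> mA; apply: mono_class_pairing;
  [exact: bmf_indic|exact: bmf_Dop_indic|exact: indic01|].
by move=> x; apply: Dop01; [exact: bmf_indic|exact: indic01].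
Qed.

(** In each direction one argument is extended while the other is held fixed, then the roles are
    exchanged; fixing a tree function or an indicator keeps the class monotone. *)
Lemma involution_invariantP lam : involution_invariant (canonical_kernel R) lam <->
  (forall f g : M R -> R, treefun f -> treefun g -> pairing lam f g = pairing lam g f).
Proof.
split=> [inv f g Tf Tg|sym A B mA mB].
  have sym_indic_treefun (A : set (borel (M R))) h : measurable A -> treefun h ->
      pairing lam h (\1_A) = pairing lam (\1_A) h.
    move=> mA Th; have [mh _] := treefun_bmf Th.
    have indicP (B : set (borel (M R))) : measurable B ->
        [/\ bmf (\1_B : borel (M R) -> R), bmf (Dop (\1_B) : borel (M R) -> R) &
        pairing lam (\1_B) (\1_A) = pairing lam (\1_A) (\1_B)].
      move=> mB; split; [exact: bmf_indic|exact: bmf_Dop_indic|].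
      have e := etrans (esym (pairing_indic lam mB mA)) (inv B A mB mA).
      exact: EFin_inj (etrans e (pairing_indic lam mA mB)).
    by have [_ _ e] := mono_class_measurable (mono_class_pairing_indic lam mA)
      indicP mh (treefun01 Th).
  have [mf _] := treefun_bmf Tf.
  have indicP (B : set (borel (M R))) : measurable B ->
        [/\ bmf (\1_B : borel (M R) -> R), bmf (Dop (\1_B) : borel (M R) -> R) &
      pairing lam (\1_B) g = pairing lam g (\1_B)].
    move=> mB; split; [exact: bmf_indic|exact: bmf_Dop_indic|].
    exact: esym (sym_indic_treefun _ _ mB Tg).
  by have [_ _ e] := mono_class_measurable (mono_class_pairing_treefun lam Tg)
    indicP mf (treefun01 Tf).
have sym_indic_treefun h : treefun h -> pairing lam (\1_B) h = pairing lam h (\1_B).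
  move=> Th.
  have TP f : treefun f -> [/\ bmf (f : borel (M R) -> R), bmf (Dop f : borel (M R) -> R) &
      pairing lam f h = pairing lam h f].
    by move=> Tf; split; [exact: treefun_bmf|exact: treefun_bmf (treefun_D Tf)|exact: sym].
  by have [_ _ e] := treefun_monotone_class (mono_class_pairing_treefun lam Th) TP mB.
have TP f : treefun f -> [/\ bmf (f : borel (M R) -> R), bmf (Dop f : borel (M R) -> R) &
    pairing lam f (\1_B) = pairing lam (\1_B) f].
  move=> Tf; split; [exact: treefun_bmf|exact: treefun_bmf (treefun_D Tf)|].
  exact: esym (sym_indic_treefun _ Tf).
have [_ _ e] := treefun_monotone_class (mono_class_pairing_indic lam mB) TP mA.
apply: etrans (pairing_indic lam mA mB) _.
exact: etrans (congr1 (@EFin R) e) (esym (pairing_indic lam mB mA)).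
Qed.

Lemma rootval_invariant lam (F : sgraph) (o o' : F) : is_tree F ->
  involution_invariant (canonical_kernel R) lam ->
  \int[lam]_x (rootval o x : R) = \int[lam]_x (rootval o' x : R).
Proof.
move=> tF /involution_invariantP sym; have [_ conn _] := tF.
have /connectP[s + ->] := conn o o'.
elim: s o => [//|v s IH] o /= /andP[ov /IH <-].
have vo : adj v o by rewrite adj_sym.
rewrite (rootval_edge R tF ov) (rootval_edge R tF vo).
by apply: sym; exact: branch__treefun.
Qed.

End involution.

(** * Existence of labelings *)

Section labelings.
Variable F : sgraph.

Lemma labeling_nlabeling (o : F) (l : {ffun 'I_#|F| -> F})
    (p : {ffun 'I_#|F| -> 'I_#|F|}) : (0 < #|F|)%N -> labeling o l p ->
  exists l' p', nlabeling o #|F| l' p' /\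
    behead [seq val (p i) | i <- enum 'I_#|F|] = [seq p' i | i <- iota 1 #|F|.-1].
Proof.
move=> F0 /and3P[/injectiveP linj /forallP l0 /forallP lp].
pose i0 : 'I_#|F| := Ordinal F0.
pose l' i := l (insubd i0 i); pose p' i := val (p (insubd i0 i)).
have insubE i : (i < #|F|)%N -> val (insubd i0 i) = i by move=> iF; rewrite insubdK.
have insubO (i : 'I_#|F|) : insubd i0 (val i) = i by exact: valKd.
exists l', p'; split; last first.
  have -> : [seq val (p i) | i <- enum 'I_#|F|] = [seq p' i | i <- iota 0 #|F|].
    rewrite -val_enum_ord -map_comp; apply: eq_map => i /=.
    by rewrite /p' insubO.
  by rewrite -{1}(prednK F0).
split.
- by move=> i j iF jF /linj /(congr1 val); rewrite /= !insubE.
- move=> v; have : v \in codom l by apply: inj_card_onto; rewrite // card_ord.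
  by move=> /codomP[i ->]; exists i => //; rewrite /l' insubO.
- by split=> //; apply/eqP; have := l0 i0; rewrite /l' (insubO i0).
- move=> i i_gt0 iF; have := lp (insubd i0 i).
  move=> /forallP h.
  have pi_lt : (p' i < i)%N.
    have := h (p (insubd i0 i)); rewrite !insubE// i_gt0 eqxx/= => /eqP/andP[].
    by [].
  split=> // j ji; have jF := ltn_trans ji iF.
  have := h (insubd i0 j); rewrite !insubE// i_gt0 ji/= => /eqP ->.
  by rewrite -val_eqE/= insubE.
Qed.

Section growth.
Variables (o : F) (tF : is_tree F).

Let grown (s : seq F) := [/\ uniq s, nth o s 0 = o &
  forall i, (0 < i)%N -> (i < size s)%N ->
    exists2 j, (j < i)%N & adj (nth o s i) (nth o s j)].

Let exit_node (s : seq F) : o \in s -> (size s < #|F|)%N ->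
  exists2 v, v \notin s & exists2 u, u \in s & adj v u.
Proof.
move=> os sF; have [_ conn _] := tF.
have [w ws] : exists w, w \notin s.
  apply: contrapT => h; have := max_card (mem s).
  move: sF; rewrite ltnNge => /negP + _; apply.
  rewrite cardE; apply: uniq_leq_size; first exact: enum_uniq.
  by move=> w _; apply/negPn/negP => ws; apply: h; exists w.
have /connectP[p + wE] := conn o w.
elim: p o os wE => [|v p IH] u us /= wE; first by move: ws; rewrite wE us.
move=> /andP[uv pth]; have [vs|vs] := boolP (v \in s); first exact: IH vs wE pth.
by exists v => //; exists u => //; rewrite adj_sym.
Qed.

Let grown_exists k : (0 < k)%N -> (k <= #|F|)%N -> exists2 s, size s = k & grown s.
Proof.
elim: k => [//|[|k] IH] _ kF.
  by exists [:: o] => //; split=> // -[].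
have [s sk [us so sadj]] := IH isT (ltnW kF).
have os : o \in s by rewrite -so mem_nth// sk.
have [v vs [u us' vu]] := exit_node os (leq_ltn_trans (eq_leq sk) kF).
exists (rcons s v); first by rewrite size_rcons sk.
split; first by rewrite rcons_uniq vs us.
  by rewrite nth_rcons sk so.
move=> i i0; rewrite size_rcons ltnS leq_eqVlt => /predU1P[->|ilt].
  exists (index u s); first by rewrite index_mem.
  by rewrite !nth_rcons ltnn eqxx index_mem us' nth_index.
have [j ji ij] := sadj i i0 ilt; exists j => //.
by rewrite !nth_rcons ilt (ltn_trans ji ilt).
Qed.

(** Two earlier neighbours of a node are joined by a path through earlier nodes, which closes up to
    a cycle at that node. *)
Let parent_unique s i j j' : grown s -> (0 < i)%N -> (i < size s)%N ->
  (j < i)%N -> (j' < i)%N -> adj (nth o s i) (nth o s j) ->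
  adj (nth o s i) (nth o s j') -> j = j'.
Proof.
move=> [us so sadj] i0 ilt ji j'i aj aj'; have [_ _ acyc] := tF.
apply: contrapT => jj'.
(* Adjacency is restricted to the nodes before index [i], so that the path found below avoids the
   [i]-th one. *)
pose e := [rel x y : F | [&& adj x y, x \in take i s & y \in take i s]].
have eC : connect_sym e.
  by apply: sym_connect_sym => x y /=; rewrite adj_sym andbA andbAC -andbA.
have mem_take m : (m < i)%N -> nth o s m \in take i s.
  by move=> mi; rewrite -(nth_take _ mi) mem_nth// size_take ilt.
have root m : (m < i)%N -> connect e (nth o s m) (nth o s 0).
  elim/ltn_ind: m => m IH mi; have [->|m0] := posnP m; first exact: connect0.
  have [k km mk] := sadj m m0 (ltn_trans mi ilt).
  apply: connect_trans (IH k km (ltn_trans km mi)).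
  by apply: connect1; rewrite /= mk !mem_take// (ltn_trans km).
have : connect e (nth o s j) (nth o s j').
  by apply: connect_trans (root j ji) _; rewrite eC; exact: root.
move=> /connectP[q0 /shortenP[q pq uq _] lq].
have qtake : {subset q <= take i s}.
  move: pq; elim: q (nth o s j) {uq lq} => [//|x q IH] y /= /andP[/and3P[_ _ xi] pq].
  by move=> z; rewrite inE => /predU1P[->//|]; exact: IH pq z.
have /acyc : ucycle (@adj F) (nth o s i :: nth o s j :: q).
  rewrite /ucycle/= aj rcons_path -lq [adj _ (nth o s i)]adj_sym aj' andbT.
  have -> : path (@adj F) (nth o s j) q.
    by apply: sub_path pq => x y /and3P[].
  rewrite /= in uq; rewrite uq andbT.
  have inotin : nth o s i \notin take i s.
    apply/negP => /(nthP o)[m]; rewrite size_take ilt => mi.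
    rewrite nth_take// => /eqP; rewrite nth_uniq//; last exact: ltn_trans ilt.
    by move=> /eqP mE; rewrite mE ltnn in mi.
  rewrite andTb andbT; apply: contra _ inotin; rewrite inE => /predU1P[->|/qtake//].
  exact: mem_take.
case: q lq {pq uq qtake} => [/= /eqP|//].
by rewrite nth_uniq ?(ltn_trans _ ilt)// => /eqP/esym.
Qed.

(** This excludes the default value [0] of [rooted_tree_density]. *)
Lemma labeling_exists : exists lp : {ffun 'I_#|F| -> F} * {ffun 'I_#|F| -> 'I_#|F|},
  labeling o lp.1 lp.2.
Proof.
have [F0 _ _] := tF.
have [s ss gs] := grown_exists F0 (leqnn _); have [us so sadj] := gs.
pose Q (i j : 'I_#|F|) := (0 < i)%N -> (j < i)%N /\ adj (nth o s i) (nth o s j).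
have exQ i : exists j, Q i j.
  have [i0|i0] := posnP i; first by exists i; rewrite /Q i0.
  have [|j ji ij] := sadj i i0; first by rewrite ss.
  by exists (Ordinal (ltn_trans ji (ltn_ord i))).
have [p pP] := boolp.choice exQ.
exists ([ffun i : 'I_#|F| => nth o s i], finfun p); apply/and3P; split.
- apply/injectiveP => i j; rewrite !ffunE => /eqP; rewrite nth_uniq ?ss//.
  by move=> /eqP/val_inj.
- by apply/forallP => i; apply/implyP => /eqP i0; rewrite ffunE i0 so.
- apply/forallP => i; apply/forallP => j; apply/implyP => i0; rewrite !ffunE.
  have [pi api] := pP i i0; apply/eqP; apply/idP/eqP => [/andP[ji ij]|->]; last by rewrite pi.
  by apply: val_inj; apply: (parent_unique gs i0) => //; rewrite ss.
Qed.

End growth.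
End labelings.

(** * Every tree function is a rooted density *)

Section parent_sequences.
Implicit Types (js : seq nat).

(* [js] lists, for the nodes [k, k.+1, ...], the parent of each of them. *)
Fixpoint parents (k : nat) js : bool :=
  if js is j :: js' then (j < k)%N && parents k.+1 js' else true.

Lemma parents_nth k js i : parents k js -> (i < size js)%N -> (nth 0 js i < k + i)%N.
Proof.
elim: js k i => [//|j js IH] k [|i] /= /andP[jk pjs]; first by rewrite addn0.
by rewrite ltnS => /(IH _ _ pjs); rewrite addSnnS.
Qed.

Lemma parents_cat k js1 js2 :
  parents k (js1 ++ js2) = parents k js1 && parents (k + size js1) js2.
Proof.
elim: js1 k => [|j js1 IH] k /=; first by rewrite addn0.
by rewrite IH addSnnS andbA.
Qed.

Lemma parents_iota (p : nat -> nat) k m : (0 < k)%N ->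
  (forall i, (k <= i)%N -> (i < k + m)%N -> (p i < i)%N) ->
  parents k [seq p i | i <- iota k m].
Proof.
elim: m k => [//|m IH] k k0 h /=; rewrite h ?leqnn ?addnS ?ltnS ?leq_addr//=.
by apply: IH => // i ki im; apply: h; [exact: ltnW|rewrite addnS -addSn].
Qed.

Section parent_graph.
Variables (js : seq nat).
Context (pjs : parents 1 js).
Let n := (size js).+1.
(** Node [0] is the root, so the list starts with the parent of node [1]. *)
Let par (i : nat) := nth 0 js i.-1.

Let par_lt i : (0 < i)%N -> (i < n)%N -> (par i < i)%N.
Proof.
case: i => // i _; rewrite /par/= ltnS => /(parents_nth pjs).
by rewrite add1n.
Qed.

Definition parent_adj : rel 'I_(size js).+1 := fun i j =>
  ((j < i)%N && (par i == j)) || ((i < j)%N && (par j == i)).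

Lemma parent_adj_sym : symmetric parent_adj.
Proof. by move=> i j; rewrite /parent_adj orbC. Qed.

Lemma parent_adj_irrefl : irreflexive parent_adj.
Proof. by move=> i; rewrite /parent_adj ltnn. Qed.

Definition parent_graph : sgraph := SGraph parent_adj_sym parent_adj_irrefl.

Let parent_graph_connect (i : parent_graph) :
  connect (@adj parent_graph) i (ord0 : 'I_n).
Proof.
move: {2}(val i) (leqnn (val i)) => m; elim: m i => [|m IH] i im.
  rewrite (_ : i = ord0) ?connect0//; apply: val_inj.
  by apply/eqP; rewrite -leqn0.
have [i0|i0] := posnP (val i).
  by rewrite (_ : i = ord0) ?connect0//; exact: val_inj.
have pi := par_lt i0 (ltn_ord i).
apply: (@connect_trans _ _ (Ordinal (ltn_trans pi (ltn_ord i)) : parent_graph)).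
  by apply: connect1; rewrite /= /parent_adj/= pi eqxx.
by apply: IH; rewrite /= -ltnS (leq_trans pi).
Qed.

(* The largest node of a cycle would have two smaller neighbours. *)
Lemma parent_graph_tree : is_tree parent_graph.
Proof.
split; first by rewrite card_ord.
  move=> x y; apply: connect_trans (parent_graph_connect x) _.
  by rewrite sym_connect_sym//; exact: parent_adj_sym.
move=> c uc; rewrite leqNgt; apply/negP => c3.
have [x xc xmax] : exists2 x : parent_graph, x \in c &
    forall y : parent_graph, y \in c -> (val y <= val x)%N.
  case: c c3 {uc} => // x0 c _.
  have x0c : x0 \in x0 :: c by rewrite mem_head.
  case: (arg_maxnP (fun y : parent_graph => val y) x0c) => x xc xmax.
  by exists x.
have [i c' cE] := rot_to xc.
have ucr : ucycle (@adj parent_graph) (x :: c') by rewrite -cE rot_ucycle.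
have xmax' y : y \in c' -> (val y <= val x)%N.
  by move=> yc; apply: xmax; rewrite -(mem_rot i) cE inE yc orbT.
have : (2 <= size c')%N by rewrite -ltnS -[X in (_ < X)%N]/(size (x :: c')) -cE size_rot.
case: c' cE ucr xmax' => [//|y c'] cE; case/lastP: c' cE => [//|c' z] cE ucr xmax' _.
move: ucr; rewrite /ucycle => /andP[/=].
rewrite rcons_path last_rcons => /andP[xy /andP[_ zx]].
rewrite !inE !mem_rcons !inE !negb_or => /and3P[/and3P[xny xnz _] /andP[ynz _] _].
have parE (w : parent_graph) : w \in y :: rcons c' z -> x != w -> adj x w ->
    par (val x) = val w.
  move=> wc xw; rewrite /= /parent_adj => /orP[/andP[_ /eqP//]|/andP[xltw _]].
  by have := xmax' w wc; rewrite leqNgt xltw.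
have yE := parE y (mem_head _ _) xny xy.
have zE : par (val x) = val z.
  by apply: parE => //; [rewrite inE mem_rcons mem_head orbT|rewrite adj_sym].
by move: ynz; rewrite -val_eqE/= -yE zE eqxx.
Qed.

Lemma parent_graph_nlabeling :
  nlabeling (ord0 : parent_graph) (size js).+1 (fun i => inord i) par.
Proof.
split.
- by move=> i j ilt jlt /(congr1 val); rewrite /= !inordK.
- by move=> v; exists (val v); [exact: ltn_ord|exact: inord_val].
- by split=> //; apply: val_inj; rewrite /= inordK.
- move=> i i0 ilt; split; first exact: par_lt.
  move=> j ji; have jlt := ltn_trans ji ilt.
  rewrite /= /parent_adj !inordK// ji/=.
  by rewrite ltnNge (ltnW ji)/= orbF eq_sym.
Qed.

Lemma parent_graph_seq : [seq par i | i <- iota 1 (size js)] = js.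
Proof.
apply: (@eq_from_nth _ 0); first by rewrite size_map size_iota.
move=> i; rewrite size_map size_iota => ilt.
by rewrite (nth_map 0%N) ?size_iota// nth_iota.
Qed.

End parent_graph.

Section iterated.
Variable R : realType.
Local Notation I := (iterated_integral (canonical_kernel R)).

(** Later variables are appended to both lists, so beyond the given ones [s] must be a shift. *)
Lemma iterated_integral_rename js (s : nat -> nat) (xs ys : seq (M R)) :
  parents (size xs) js ->
  (forall i, (i < size xs)%N -> (s i < size ys)%N /\ nth point ys (s i) = nth point xs i) ->
  (forall i, s (size xs + i)%N = (size ys + i)%N) ->
  I js xs = I (map s js) ys.
Proof.
elim: js xs ys => [//|j js IH] xs ys /= /andP[jx pjs] sx sy.
rewrite (sx j jx).2; apply: eq_integral => x _.
apply: IH; rewrite ?size_rcons// => i; last by rewrite !addSnnS sy.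
rewrite ltnS leq_eqVlt => /predU1P[->|ix].
  by have := sy 0%N; rewrite !addn0 => ->; rewrite !nth_rcons !ltnn !eqxx.
have [sil snth] := sx i ix; rewrite !nth_rcons ix sil snth; split=> //.
exact: ltnW.
Qed.

(** Separating the variables gives finiteness and measurability in each of them, which is what
    pulling factors out of integrals requires. *)
Lemma iterated_integral_form js k : parents k js ->
  exists2 V : nat -> M R -> R, (forall i, treefun (V i)) &
    forall xs, size xs = k -> I js xs = (\prod_(i < k) V i (nth point xs i))%:E.
Proof.
elim: js k => [|j js IH] k /= => [_|/andP[jk /IH[V TV VE]]].
  by exists (fun _ _ => 1) => [i|xs _]; [exact: treefun1|rewrite big1].
exists (fun i => if i == j then fun x => V i x * Dop (V k) x else V i).
  by move=> i; case: ifP => // _; apply: treefun_mul => //; exact: treefun_D.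
move=> xs sxs.
pose c := \prod_(i < k) V i (nth point xs i).
transitivity (\int[sdeg (nth point xs j)]_x (c * V k x)%:E)%E.
  apply: eq_integral => x _; rewrite VE ?size_rcons ?sxs//.
  congr (_%:E); rewrite big_ord_recr/= nth_rcons sxs ltnn eqxx; congr (_ * _).
  by apply: eq_bigr => i _; rewrite nth_rcons sxs ltn_ord.
have bV : bmf (V k : borel (M R) -> R) by exact: treefun_bmf.
rewrite bint_EFin ?bint_scale//; last exact: bmf_scale.
congr (_%:E); rewrite -/(Dop _ _) /c.
rewrite (bigD1 (Ordinal jk))//= [RHS](bigD1 (Ordinal jk))//= eqxx.
rewrite mulrAC; congr (_ * _); apply: eq_bigr => i.
by rewrite -val_eqE/= => /negbTE ->.
Qed.

(** Gluing at the root: the second block depends on the root variable only, so it is a constant for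
    all the integrations of the first. *)
Lemma iterated_integral_cat js1 js2 (xs : seq (M R)) (b : R) :
  parents (size xs) js1 ->
  (forall ys, size ys = (size xs + size js1)%N ->
     nth point ys 0 = nth point xs 0 -> I js2 ys = b%:E) -> (0 < size xs)%N ->
  I (js1 ++ js2) xs = (I js1 xs * b%:E)%E.
Proof.
elim: js1 xs => [|j js1 IH] xs /= => [_ h _|/andP[jx pjs] h x0].
  by rewrite mul1e h// addn0.
have [V TV VE] := iterated_integral_form pjs.
pose c := \prod_(i < size xs) V i (nth point xs i).
have IE x : I js1 (rcons xs x) = (c * V (size xs) x)%:E.
  rewrite VE ?size_rcons//.
  congr (_%:E); rewrite big_ord_recr/= nth_rcons ltnn eqxx; congr (_ * _).
  by apply: eq_bigr => i _; rewrite nth_rcons ltn_ord.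
transitivity (\int[sdeg (nth point xs j)]_x (b * (c * V (size xs) x))%:E)%E.
  apply: eq_integral => x _; rewrite IH ?size_rcons// => [|ys sys ys0].
    by rewrite IE -EFinM mulrC.
  by apply: h; rewrite ?sys ?addSnnS// ys0 nth_rcons x0.
have bV : bmf (fun x : borel (M R) => c * V (size xs) x) by apply/bmf_scale/treefun_bmf.
have -> : (\int[canonical_kernel R (nth point xs j)]_x I js1 (rcons xs x) =
    (\int[sdeg (nth point xs j)]_x (c * V (size xs) x))%:E)%E.
  by rewrite -bint_EFin//; apply: eq_integral => x _; exact: IE.
by rewrite bint_EFin; [rewrite bint_scale// -EFinM mulrC|exact: bmf_scale].
Qed.

Lemma treefun_parents (g : M R -> R) : treefun g -> exists2 js, parents 1 js &
  forall x, I js [:: x] = (g x)%:E.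
Proof.
move=> [r [f [tff ->]]].
elim: tff => {r f g} [r|r f g _ [js1 p1 E1] _ [js2 p2 E2]|r f tff [js p E]].
- by exists [::].
(* The second tree keeps the common root [0], and its other nodes are numbered after those of the
   first. *)
- pose s i := if i is 0 then 0%N else (i + size js1)%N.
  exists (js1 ++ map s js2).
    rewrite parents_cat p1/=.
    have : forall k, (0 < k)%N -> parents k js2 -> parents (k + size js1) (map s js2).
      elim: (js2) => [//|j js IH] k k0 /= /andP[jk pj]; rewrite -addSn IH// andbT.
      by case: j jk => [|j] jk /=; rewrite ?ltn_add2r ?addn_gt0 ?k0.
    by move=> /(_ 1%N isT p2).
  move=> x; rewrite (@iterated_integral_cat _ _ _ (g (coord r x)))//; last first.
    move=> ys sys ys0; rewrite -E2.
    apply/esym; apply: iterated_integral_rename => //.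
      by case=> // _; rewrite sys ys0.
    by move=> i; rewrite sys /=; lia.
  by rewrite E1.
(* A new root is put above the old one, which becomes node [1]. *)
- exists (0 :: map S js)%N => /=.
    have : forall k, parents k js -> parents k.+1 (map S js).
      by elim: (js) => [//|j js' IH] k /= /andP[jk /IH ->]; rewrite ltnS jk.
    exact.
  move=> x.
  transitivity (\int[sdeg x]_y (f (coord r y))%:E)%E.
    apply: eq_integral => y _; rewrite -E.
    by apply/esym; apply: iterated_integral_rename.
  have bf : bmf (fun y : borel (M R) => f (coord r y)) by apply: treefun_bmf; exists r, f.
  by rewrite bint_EFin// sdeg_coord//; exact: treefun__bmf.
Qed.

End iterated.
End parent_sequences.

(** * Homomorphism numbers *)

Section homomorphisms.
Variables (F G : sgraph) (x0 : G).

Fixpoint iterated_sum (js : seq nat) (xs : seq G) : nat :=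
  if js is j :: js' then
    \sum_(y | adj (nth x0 xs j) y) iterated_sum js' (rcons xs y)
  else 1%N.

Section nlabeling.
Variables (o : F) (n : nat) (l : nat -> F) (p : nat -> nat).
Context (lab : nlabeling o n l p).

(** Edges among the [k] prescribed nodes are left untested, as [iterated_sum] does not check [xs]
    either. *)
Let ext (k : nat) (xs : seq G) : pred {ffun F -> G} := fun h =>
  [forall i : 'I_k, h (l i) == nth x0 xs i] &&
  [forall i : 'I_n, (k <= i)%N ==> adj (h (l (p i))) (h (l i))].

Lemma iterated_sum_ext k xs : (0 < k)%N -> (k <= n)%N -> size xs = k ->
  iterated_sum [seq p i | i <- iota k (n - k)] xs = #|ext k xs|.
Proof.
have [linj lsurj _ lp] := lab.
move=> k0 kn; rewrite -(subKn kn) in k0 *.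
elim: (n - k)%N xs k0 (leq_subr k n) => [|j IH] xs k0 jn sxs.
  rewrite subn0 subnn/= in sxs *; apply/esym.
  have [g gP] : {g : F -> 'I_n & forall v, l (g v) = v}.
    apply: (@choice _ _ (fun v (i : 'I_n) => l i = v)) => v.
    by have [i ilt <-] := lsurj v; exists (Ordinal ilt).
  have gK (i : 'I_n) : g (l i) = i.
    by apply: val_inj; apply: linj; [exact: ltn_ord|exact: ltn_ord|exact: (gP (l i))].
  apply: (fintype.eq_card1 (x := [ffun v : F => nth x0 xs (g v)] : {ffun F -> G})) => h.
  rewrite !inE unfold_in /ext; apply/andP/eqP => [[/forallP hx _]|->].
    by apply/ffunP => v; rewrite ffunE -(eqP (hx (g v))) gP.
  split; first by apply/forallP => i; rewrite ffunE gK.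
  by apply/forallP => i; rewrite leqNgt ltn_ord.
set k' := (n - j.+1)%N in k0 sxs *.
have k'n : (k' < n)%N by rewrite /k'; lia.
have jk' : (n - j)%N = k'.+1 by rewrite /k'; lia.
have -> : (n - k')%N = (n - k'.+1).+1 by lia.
have [pk _] := lp k' k0 k'n.
rewrite [LHS]/= -[RHS]sum1_card.
rewrite (partition_big (fun h : {ffun F -> G} => h (l k'))
  (fun y => adj (nth x0 xs (p k')) y)); last first.
  move=> h /andP[/forallP hx /forallP ha].
  by have := ha (Ordinal k'n); rewrite leqnn/= (eqP (hx (Ordinal pk))).
apply: eq_bigr => y xy.
have := IH (rcons xs y); rewrite jk' size_rcons sxs => /(_ isT (ltnW jn) erefl) ->.
rewrite -sum1_card; apply: eq_bigl => h; rewrite !unfold_in /ext.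
apply/andP/andP => [[/forallP hx /forallP ha]|[/andP[/forallP hx /forallP ha] /eqP hk]].
  have hk : h (l k') = y by rewrite (eqP (hx ord_max)) nth_rcons sxs ltnn eqxx.
  have hx' (i : 'I_k') : h (l i) = nth x0 xs i.
    by have := eqP (hx (widen_ord (leqnSn k') i)); rewrite /= nth_rcons sxs ltn_ord.
  split; last by rewrite hk.
  apply/andP; split; first by apply/forallP => i; rewrite hx'.
  apply/forallP => i; apply/implyP; rewrite leq_eqVlt => /predU1P[ik|].
    by rewrite -ik hk (hx' (Ordinal pk)).
  by move: (ha i) => /implyP; apply.
split; last first.
  apply/forallP => i; apply/implyP => ki; have /implyP := ha i; apply.
  exact: ltnW.
apply/forallP => i; rewrite nth_rcons sxs; have [ik|ki] := ltnP i k'.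
  by rewrite (eqP (hx (Ordinal ik))).
have -> : val i = k' by apply/eqP; rewrite eqn_leq ki -ltnS ltn_ord.
by rewrite eqxx hk.
Qed.

(** Every edge of the tree joins some [i] to [p i], so testing these edges tests all of them. *)
Lemma hom_iterated_sum :
  Defs.hom F G = \sum_x iterated_sum [seq p i | i <- iota 1 n.-1] [:: x].
Proof.
have [linj lsurj [n0 _] lp] := lab.
rewrite /Defs.hom -sum1_card (partition_big (fun h : {ffun F -> G} => h (l 0%N)) predT)//.
apply: eq_bigr => y _; rewrite -subn1 iterated_sum_ext// -sum1_card.
apply: eq_bigl => h; rewrite !unfold_in /in_set asboolb /ext.
apply/andP/andP => [[/forallP ha /eqP hy]|[/forallP hx /forallP ha]].
  split; first by apply/forallP => i; rewrite ord1/= hy.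
  apply/forallP => i; apply/implyP => i0; have [pi ladj] := lp i i0 (ltn_ord i).
  have /forallP/(_ (l i))/implyP := ha (l (p i)); apply.
  by rewrite adj_sym ladj.
split; last by rewrite (eqP (hx ord0)).
have hadj i j : (j < i)%N -> (i < n)%N -> adj (l i) (l j) -> adj (h (l i)) (h (l j)).
  move=> ji ilt; have i0 := leq_ltn_trans (leq0n j) ji.
  have [_ ladj] := lp i i0 ilt; rewrite ladj// => /eqP ->.
  by have /implyP/(_ i0) := ha (Ordinal ilt); rewrite adj_sym.
apply/forallP => u; apply/forallP => v; apply/implyP.
have [i ilt <-] := lsurj u; have [j jlt <-] := lsurj v.
have [ij|ji|->] := ltngtP i j; last by rewrite adj_irrefl.
  by rewrite adj_sym => /hadj; rewrite adj_sym; apply.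
exact: hadj.
Qed.

End nlabeling.
End homomorphisms.

(** * Graphs as points of the space of consistent sequences *)

Section atoms.
Context dd (T : measurableType dd) (R : realType).
Implicit Types (d : nat) (ys : seq T).

Let natV_ge0 d : 0 <= d%:R^-1 :> R. Proof. by rewrite invr_ge0. Qed.

(* Mass [1/d] at each of the first [d] points of [ys]; [d = 0] gives the zero
   measure. *)
Definition atoms_measure d ys : {measure set T -> \bar R} :=
  mscale (NngNum (natV_ge0 d))
    (msum (fun i => \d_(nth point ys i)) (minn d (size ys))).

Lemma atoms_measure_le1 d ys : (atoms_measure d ys setT <= 1)%E.
Proof.
rewrite /= /mscale/= /msum (eq_bigr (fun=> 1%E)); last first.
  by move=> i _; rewrite /= diracE in_setT.
rewrite sumEFin sumr_const card_ord -EFinM lee_fin -[_ *+ _]/((_)%:R).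
have [->|d0] := posnP d; first by rewrite invr0 mul0r ler01.
by rewrite ler_pdivrMl ?ltr0n// mulr1 ler_nat geq_minl.
Qed.

Definition atoms d ys : subprobability T R := le1_measure (atoms_measure_le1 d ys).

Lemma atoms_int d ys (f : T -> R) : (size ys <= d)%N -> bmf f ->
  (forall x, 0 <= f x) ->
  \int[atoms d ys]_x f x = d%:R^-1 * \sum_(y <- ys) f y.
Proof.
move=> sd [mf _] f0; rewrite /Rintegral.
have mfE : measurable_fun setT (EFin \o f) by exact/measurable_EFinP.
have fE0 x : setT x -> (0 <= (f x)%:E)%E by rewrite lee_fin.
rewrite ge0_integral_mscale//= ge0_integral_measure_sum//.
rewrite (eq_bigr (fun i : 'I_(minn d (size ys)) => (f (nth point ys i))%:E)); last first.
  by move=> i _; rewrite integral_dirac// diracE in_setT mul1e.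
rewrite sumEFin -EFinM/= (minn_idPr sd) (big_nth point) big_mkord.
by [].
Qed.

Lemma atomsE d ys (A : set T) : (size ys <= d)%N -> measurable A ->
  atoms d ys A = (d%:R^-1 * \sum_(y <- ys) \1_A y)%:E.
Proof.
move=> sd mA; rewrite -atoms_int//; last exact: bmf_indic.
by rewrite bint_indic// fineK// subprobability_fin.
Qed.

End atoms.

Section laws.
Variable R : realType.
Implicit Types (d : nat) (K L : pmetricType R).

Definition matoms K d (ys : seq K) : measures K :=
  of_subprobability (atoms R d (ys : seq (borel K))).

Lemma matomsE K d (ys : seq K) (A : set (borel K)) : (size ys <= d)%N ->
  measurable A -> sval (matoms d ys) A = (d%:R^-1 * \sum_(y <- ys) \1_A y)%:E.
Proof. by move=> sd mA; rewrite /matoms/= trimE// atomsE. Qed.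

Lemma push_matoms K L (f : K -> L) (uf : unif_continuous f) d (ys : seq K) :
  (size ys <= d)%N -> push uf (matoms d ys) = matoms d (map f ys).
Proof.
move=> sd; apply: measures_eq => A mA.
rewrite pushE// !matomsE ?size_map//; last exact: measurable_preimage.
by rewrite big_map.
Qed.

(** A measure on [M] is determined by cylinders, so atomic laws at all levels force an atomic
    measure on [M] itself. *)
Lemma sdeg_matoms (s : M R) d (ys : seq (M R)) : (size ys <= d)%N ->
  (forall r, coord r.+1 s = matoms d (map (@coord R r) ys)) ->
  forall f : borel (M R) -> R, bmf f -> (forall x, 0 <= f x) ->
    Dop f s = d%:R^-1 * \sum_(y <- ys) f y.
Proof.
move=> sd sE f bf f0.
rewrite -(@atoms_int _ (borel (M R)) R d ys f)//.
apply: (@bint_image _ (borel (M R)) _ (borel (M R)) _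
  (atoms R d (ys : seq (borel (M R)))) (sdeg s) id f) => //.
apply: measure_eq_cyls => r A mA.
rewrite sdeg_cyl// sE matomsE ?size_map// atomsE//; last exact: cyl_measurable.
by rewrite big_map; congr (_ * _)%:E; exact: eq_bigr.
Qed.

(* The point of [M] whose measure on each [M_ r] is the law of [coord r] at a
   uniformly chosen element of [ys]. *)
Definition law_fun d (ys : seq (M R)) (r : nat) : M_ R r :=
  if r is r'.+1 return M_ R r then matoms d (map (@coord R r') ys) else point.

Lemma law_consistent d ys : (size ys <= d)%N -> consistent (law_fun d ys).
Proof.
move=> sd [|r]; first exact: M_0_eq.
rewrite /= push_matoms ?size_map//; congr matoms; rewrite -map_comp.
by apply: eq_map => s /=; rewrite coordS.
Qed.

Section graph.
Variables (G : sgraph) (d : nat).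
Context (Gd : admissible G d).

Definition nbrs (x : G) : seq G := [seq y <- enum G | adj x y].

Lemma size_nbrs x : (size (nbrs x) <= d)%N.
Proof.
have [_ _ /(_ x)] := Gd; apply: leq_trans.
rewrite cardE /nbrs /enum_mem -filter_predI; apply: uniq_leq_size.
  by rewrite filter_uniq// -enumT enum_uniq.
move=> y; rewrite !mem_filter /= => /andP[/andP[xy _] ye]; rewrite ye andbT.
by rewrite !unfold_in /in_set asboolb.
Qed.

Fixpoint node_ (r : nat) (x : G) : M_ R r :=
  if r is r'.+1 return M_ R r then matoms d [seq node_ r' y | y <- nbrs x] else point.

Lemma node_consistent x : consistent (fun r => node_ r x : M_ R r).
Proof.
move=> r; elim: r x => [|r IH] x; first exact: M_0_eq.
rewrite /= push_matoms ?size_map ?size_nbrs//; congr matoms; rewrite -map_comp.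
by apply: eq_map => y /=; exact: IH.
Qed.

Definition node (x : G) : M R :=
  exist (fun t => t \in @consistent R) _ (mem_set (node_consistent x)).

Lemma Dop_node (f : borel (M R) -> R) x : bmf f -> (forall x, 0 <= f x) ->
  Dop f (node x) = d%:R^-1 * \sum_(y | adj x y) f (node y).
Proof.
move=> bf f0.
rewrite (@sdeg_matoms _ d [seq node y | y <- nbrs x])// ?size_map ?size_nbrs//; last first.
  move=> r; rewrite -map_comp [LHS]/coord set_valE/=; congr matoms.
congr (_ * _); rewrite big_map /nbrs big_filter.
by rewrite big_enum_cond.
Qed.

Lemma enum_size_le : (size [seq node x | x <- enum G] <= #|G|)%N.
Proof. by rewrite size_map cardE. Qed.

(* The law of [node] at a uniformly random vertex is the measure attached to
   this point. *)
Definition graph_point : M R :=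
  exist (fun t => t \in @consistent R) _ (mem_set (law_consistent enum_size_le)).

Lemma Dop_graph_point (f : borel (M R) -> R) : bmf f -> (forall x, 0 <= f x) ->
  Dop f graph_point = #|G|%:R^-1 * \sum_x f (node x).
Proof.
move=> bf f0.
rewrite (@sdeg_matoms _ #|G| [seq node x | x <- enum G])// ?enum_size_le//.
by rewrite big_map big_enum.
Qed.

(** Up to a common factor both sides sum [f] at one end times [g] at the other over ordered adjacent
    pairs. *)
Lemma graph_point_sym (f g : M R -> R) : treefun f -> treefun g ->
  Dop (fun x => f x * Dop g x) graph_point = Dop (fun x => g x * Dop f x) graph_point.
Proof.
move=> Tf Tg.
have T0 h : treefun h -> forall x, 0 <= h x by move=> /treefun01 h01 x; have /andP[] := h01 x.
have TfDg : treefun (fun x => f x * Dop g x) by apply: treefun_mul => //; exact: treefun_D.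
have TgDf : treefun (fun x => g x * Dop f x) by apply: treefun_mul => //; exact: treefun_D.
rewrite !Dop_graph_point; [|exact: treefun_bmf|exact: T0|exact: treefun_bmf|exact: T0].
congr (_ * _).
have E (h k : M R -> R) : treefun k -> \sum_x h (node x) * Dop k (node x) =
    d%:R^-1 * \sum_x \sum_(y | adj x y) h (node x) * k (node y).
  move=> Tk; rewrite mulr_sumr; apply: eq_bigr => x _.
  rewrite Dop_node; [|exact: treefun_bmf|exact: T0].
  by rewrite mulrCA mulr_sumr.
rewrite !E//; congr (_ * _).
rewrite (exchange_big_dep predT)//=; apply: eq_bigr => x _.
by apply: eq_big => [y|y _]; [exact: adj_sym|rewrite mulrC].
Qed.

Lemma iterated_integral_node js (x0 : G) (xs : seq G) : parents (size xs) js ->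
  iterated_integral (canonical_kernel R) js (map node xs) =
  (d%:R^-1 ^+ size js * (iterated_sum x0 js xs)%:R)%:E.
Proof.
elim: js xs => [|j js IH] xs /= => [_|/andP[jx pjs]]; first by rewrite mul1r.
(* The integrand must be a bounded measurable function on all of [M], not just at images of nodes,
   before [Dop_node] applies. *)
have [V TV VE] := iterated_integral_form R pjs.
pose c := \prod_(i < size xs) V i (nth point (map node xs) i).
have cE x : iterated_integral (canonical_kernel R) js (rcons (map node xs) x) =
    (c * V (size xs) x)%:E.
  rewrite VE ?size_rcons ?size_map//.
  congr (_%:E); rewrite big_ord_recr/= nth_rcons size_map ltnn eqxx; congr (_ * _).
  by apply: eq_bigr => i _; rewrite nth_rcons size_map ltn_ord.
have bV : bmf (V (size xs) : borel (M R) -> R) by exact: treefun_bmf.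
transitivity (\int[sdeg (nth point (map node xs) j)]_x (c * V (size xs) x)%:E)%E.
  by apply: eq_integral => x _; exact: cE.
rewrite bint_EFin ?bint_scale//; last exact: bmf_scale.
congr (_%:E); rewrite -/(Dop _ _) (nth_map x0)// Dop_node//; last first.
  by move=> x; have /andP[] := treefun01 (TV (size xs)) x.
rewrite mulrCA exprS -mulrA; congr (_ * _).
rewrite natr_sum !mulr_sumr; apply: eq_bigr => y _.
have := IH (rcons xs y); rewrite size_rcons => /(_ pjs).
by rewrite map_rcons cE => -[].
Qed.

End graph.
End laws.

(** * Densities and the limit law *)

Section densities.
Variable R : realType.

Lemma nlabeling_exists (F : sgraph) (o : F) : is_tree F ->
  exists l p, nlabeling o #|F| l p.
Proof.
move=> tF; have [F0 _ _] := tF; have [[l p] lab] := labeling_exists o tF.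
by have [l' [p' [nlab _]]] := labeling_nlabeling F0 lab; exists l', p'.
Qed.

Lemma tree_density_rootval (F : sgraph) : is_tree F ->
  exists o : F, forall lam : probability (borel (M R)) R,
    tree_density (canonical_kernel R) lam F = (\int[lam]_x (rootval o x : R))%:E.
Proof.
move=> tF; have [F0 _ _] := tF.
rewrite /tree_density; case: pickP => [v _|nF]; last first.
  by have /card_gt0P[v _] := F0; have := nF v.
exists v => lam; rewrite -bint_EFin; last exact/treefun_bmf/rootval_treefun.
apply: eq_integral => x _; rewrite /rooted_tree_density.
case: pickP => [lp lab|nlp]; last first.
  by have [lp] := labeling_exists v tF; rewrite nlp.
have [l [p [nlab ->]]] := labeling_nlabeling F0 lab.
exact: (iterated_integral_rootval nlab tF x).
Qed.

(** Each of the [#|F|.-1] integrations contributes a factor [1/d], and the random root the factor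
    [1/#|G|]. *)
Lemma hom_density_rootval (F G : sgraph) (o : F) d (Gd : admissible G d) :
  is_tree F -> Dop (rootval o) (graph_point R Gd) = hom_density R F G d.
Proof.
move=> tF; have [F0 _ _] := tF; have [l [p nlab]] := nlabeling_exists o tF.
have [d0 /card_gt0P[x0 _] _] := Gd.
rewrite Dop_graph_point; [|exact/treefun_bmf/rootval_treefun|]; last first.
  by move=> x; have /andP[] := treefun01 (rootval_treefun R o) x.
rewrite /hom_density (hom_iterated_sum x0 nlab) invfM [in RHS]mulrCA.
congr (_ * _); rewrite natr_sum mulr_suml; apply: eq_bigr => x _.
have pjs : parents 1 [seq p i | i <- iota 1 #|F|.-1].
  have [_ _ _ lp] := nlab; apply: parents_iota => // i i0; rewrite add1n prednK// => iF.
  by have [] := lp i i0 iF.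
have := iterated_integral_node R Gd x0 (xs := [:: x]) pjs.
rewrite (iterated_integral_rootval nlab tF) => -[->].
by rewrite size_map size_iota exprVn mulrC.
Qed.

End densities.

Theorem theorem5p10 (R : realType) (G : nat -> sgraph) (d : nat -> nat)
    (Gd_admissible : forall n, admissible (G n) (d n))
    (Gd_cvg : forall F : sgraph, is_tree F ->
       cvgn (fun n => hom_density R F (G n) (d n))) :
  let deg := canonical_kernel R in
  let limit (lam : probability (borel (M R)) R) : Prop :=
    involution_invariant deg lam /\
    forall F : sgraph, is_tree F ->
      (hom_density R F (G n) (d n))%:E @[n --> \oo] --> tree_density deg lam F in
  exists lam : probability (borel (M R)) R,
    limit lam /\
    forall lam' : probability (borel (M R)) R, limit lam' ->
      forall A : set (borel (M R)), measurable A -> lam' A = lam A.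
Proof.
move=> deg limit.
pose s n := graph_point R (Gd_admissible n).
have [U [UU ooU]] := ultraFilterLemma eventually_filter.
have := @compact_M R; rewrite compact_ultra.
move=> /(_ _ (ultra_fmap s UU) filterT)[t [_ st]].
have Dst f : treefun f -> (fun n => Dop f (s n)) @ U --> Dop f t.
  move=> Tf; apply: (@cvg_comp _ _ _ s (Dop f) U (nbhs t)); first exact: st.
  exact: (treefun_continuous (treefun_D Tf)).
have lim_unique (u : nat -> R) (a b : R) : u @ U --> a -> u @ U --> b -> a = b.
  by move=> ua ub; exact: (cvg_unique _ ua ub).
(* A priori [deg t] is only a sub-probability measure; no mass is lost because the constant [1] is a
   tree function. *)
have deg1 : deg t setT = 1%E.
  have s1 n : Dop (fun=> 1) (s n) = 1.
    have [_ G0 _] := Gd_admissible n.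
    rewrite Dop_graph_point//; last exact: bmf_cst.
    by rewrite sumr_const mulVf// pnatr_eq0 -lt0n.
  have : Dop (fun=> 1) t = 1.
    have := Dst _ (treefun1 R); rewrite (_ : (fun n => _) = fun=> 1); last exact/funext.
    by move=> h; apply: (lim_unique _ _ _ h); exact: cvg_cst.
  move=> D1; have : \int[sdeg t]_x \1_setT x = 1 :> R.
    by rewrite -[RHS]D1; apply: eq_Rintegral => x _; rewrite indicT.
  rewrite bint_indic// => m1; have := congr1 (@EFin R) m1.
  by rewrite fineK ?subprobability_fin.
pose lam : probability (borel (M R)) R := eq1_measure deg1.
have lamE f : \int[lam]_x f x = Dop f t by [].
have limit_lam : limit lam.
  split.
    apply/involution_invariantP => f g Tf Tg.
    have TfDg : treefun (fun x => f x * Dop g x) by apply: treefun_mul => //; exact: treefun_D.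
    have TgDf : treefun (fun x => g x * Dop f x) by apply: treefun_mul => //; exact: treefun_D.
    rewrite /pairing !lamE.
    (* Both integrands are tree functions, so the symmetry at every [s n] passes to [t]. *)
    have := Dst _ TfDg.
    rewrite (_ : (fun n => _) = fun n => Dop (fun x => g x * Dop f x) (s n)).
      by move=> h; apply: (lim_unique _ _ _ h); exact: Dst.
    by apply/funext => n; exact: graph_point_sym.
  move=> F tF; have [v ->] := tree_density_rootval R tF; rewrite lamE.
  apply: cvg_EFin; first exact: nearW.
  have /cvg_ex[/= l hl] := Gd_cvg F tF.
  (* [l] is the limit along [\oo], hence also along the finer [U], where the limit is the value at
     [t]. *)
  have -> : Dop (rootval v) t = l; last exact: hl.
  have := Dst _ (rootval_treefun R v).
  rewrite (_ : (fun n => _) = fun n => hom_density R F (G n) (d n)).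
    by move=> h; apply: (lim_unique _ _ _ h); exact: cvg_trans (cvg_app _ ooU) hl.
  by apply/funext => n; exact: hom_density_rootval.
exists lam; split=> // lam' limit_lam'.
have [inv lim_] := limit_lam; have [inv' lim'] := limit_lam'.
apply: treefun_determining => f Tf.
have [js pjs jsE] := treefun_parents Tf.
have nlab := parent_graph_nlabeling pjs.
have tF := parent_graph_tree pjs.
have fE : f = rootval (ord0 : parent_graph js).
  apply/funext => x; have := iterated_integral_rootval nlab tF x.
  by rewrite /= parent_graph_seq jsE => -[].
(* Equal densities compare the two laws at the root [v] picked by [tree_density], whereas [f] is
   rooted at [ord0]; invariance of both laws moves the root. *)
have [v vE] := tree_density_rootval R tF.
have : tree_density deg lam' (parent_graph js) = tree_density deg lam (parent_graph js).
  exact: (cvg_unique (@ereal_hausdorff R) (lim' _ tF) (lim_ _ tF)).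
rewrite !vE => -[]; rewrite fE.
rewrite (rootval_invariant (ord0 : parent_graph js) v tF inv').
by rewrite (rootval_invariant (ord0 : parent_graph js) v tF inv).
Qed.
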